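(* Let $\mathfrak{g}^M$ be one of the Lie algebras $\mathfrak{gl}^M(V,W)$, $\mathfrak{o}^M(V)$, $\mathfrak{sp}^M(V)$, and let $R=V\oplus W$ if $\mathfrak{g}^M=\mathfrak{gl}^M(V,W)$ and $R=V$ if $\mathfrak{g}^M=\mathfrak{o}^M(V)$ or $\mathfrak{sp}^M(V)$. Let $\mathfrak{a}$ be a dense subalgebra of $\mathfrak{g}^M$. Then the monoidal categories $\mathbb{T}^R_{\mathfrak{g}^M}$ and $\mathbb{T}^R_{\mathfrak{a}}$ are equivalent.
   Context: The ground field is $\mathbb{C}$. $V,W$ are infinite-dimensional vector spaces with a non-degenerate pairing $V\times W\to\mathbb{C}$ (so $W\subset V^*$); in the orthogonal (respectively, symplectic) case $V$ is infinite dimensional with a non-degenerate symmetric (respectively, antisymmetric) form $(\cdot,\cdot)$. $\mathfrak{gl}^M(V,W)$ is the Lie algebra of all $\phi\in\mathrm{End}(V)$ with $\phi^*(W)\subset W$, acting on $V$ naturally and on $W$ by $-\phi^*|_W$. $\mathfrak{o}^M(V)$ (respectively, $\mathfrak{sp}^M(V)$) is the Lie algebra of all $X\in\mathrm{End}(V)$ with $(Xv,w)+(v,Xw)=0$ for all $v,w\in V$. Given a Lie algebra $\mathfrak{l}$, a subalgebra $\mathfrak{k}\subset\mathfrak{l}$ and an $\mathfrak{l}$-module $N$, $\mathfrak{k}$ acts densely on $N$ if for any finite set $r_1,\dots,r_n\in N$ and any $l\in\mathfrak{l}$ there is $k\in\mathfrak{k}$ with $k\cdot r_i=l\cdot r_i$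 for $i=1,\dots,n$. A Lie subalgebra $\mathfrak{a}\subset\mathfrak{g}^M$ is dense if it acts densely on $R$. For a Lie algebra $\mathfrak{l}$ and an $\mathfrak{l}$-module $R$, $\mathbb{T}^R_{\mathfrak{l}}$ is the full subcategory of $\mathfrak{l}$-modules consisting of all (modules isomorphic to) finite length subquotients of finite direct sums $T(R)^{\oplus n}$, $n\ge1$, where $T(R)$ is the tensor algebra of $R$; for $\mathfrak{a}\subset\mathfrak{g}^M$ the module $R$ is regarded as an $\mathfrak{a}$-module by restriction. The monoidal structure is the usual tensor product. *)

(* Defs.v *)
From HB Require Import structures.
From mathcomp Require Import all_boot all_order all_algebra.
From mathcomp Require Import all_classical.

Set Implicit Arguments.
Unset Strict Implicit.
Unset Printing Implicit Defensive.

Import GRing.Theory.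
Local Open Scope ring_scope.
Local Open Scope quotient_scope.

Lemma linear_ext (K : fieldType) (M N : lmodType K) (f g : {linear M -> N}) :
  f =1 g -> f = g.
Proof.
case: f g => f cf [g cg] /= /funext efg.
case: _ / efg in cg *; congr GRing.Linear.Pack.
case: cf cg => [[a1] [a2]] [[b1] [b2]].
by rewrite (Prop_irrelevance a1 b1) (Prop_irrelevance a2 b2).
Qed.

Definition linear_of (K : fieldType) (M N : lmodType K) (f : M -> N)
    (lf : linear f) : {linear M -> N} :=
  HB.pack f (GRing.isLinear.Build _ _ _ _ f lf).

Section SubLmodule.
Context (K : fieldType) (M : lmodType K) (S : submodClosed M).

Definition subspace_of : Type := {x : M | x \in S}.

HB.instance Definition _ := SubChoice.on subspace_of.
HB.instance Definition _ := [SubChoice_isSubLmodule of subspace_of by <:].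

End SubLmodule.

Section QuotLmodule.
Context (K : fieldType) (M : lmodType K) (S : submodClosed M).

Definition quot_pred : {pred M} := [pred x in S].
HB.instance Definition _ := GRing.isZmodClosed.Build M quot_pred
  (GRing.submod_closedB (GRing.submodClosedP S)).

Definition quotient_of : Type := Quotient.quot quot_pred.

HB.instance Definition _ := GRing.Zmodule.on quotient_of.

Definition to_quot (x : M) : quotient_of := \pi_(Quotient.quot quot_pred) x.

Lemma to_quotP x y : to_quot x = to_quot y <-> x - y \in S.
Proof.
by rewrite -[x - y \in S]/(x - y \in quot_pred) Quotient.idealrBE; split=> /eqP.
Qed.

Lemma to_quotD : {morph to_quot : x y / x + y}.
Proof. by move=> x y; rewrite /to_quot -[RHS]Quotient.pi_add. Qed.

Lemma to_quotW (P : quotient_of -> Prop) :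
  (forall x, P (to_quot x)) -> forall u, P u.
Proof. by move=> Px u; rewrite -[u]reprK; exact: Px. Qed.

Definition quot_scale (a : K) (u : quotient_of) : quotient_of :=
  to_quot (a *: repr u).

Lemma quot_scaleE a x : quot_scale a (to_quot x) = to_quot (a *: x).
Proof.
apply/to_quotP; rewrite -scalerBr rpredZ //; apply/to_quotP.
by rewrite /to_quot reprK.
Qed.

Lemma quot_scaleA a b u : quot_scale a (quot_scale b u) = quot_scale (a * b) u.
Proof. by elim/to_quotW: u => x; rewrite !quot_scaleE scalerA. Qed.
Lemma quot_scale1 : left_id 1 quot_scale.
Proof. by elim/to_quotW => x; rewrite !quot_scaleE scale1r. Qed.
Lemma quot_scaleDr : right_distributive quot_scale +%R.
Proof.
move=> a; elim/to_quotW => x; elim/to_quotW => y.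
by rewrite -to_quotD !quot_scaleE scalerDr to_quotD.
Qed.
Lemma quot_scaleDl u : {morph quot_scale^~ u : a b / a + b}.
Proof.
by move=> a b; elim/to_quotW: u => x; rewrite !quot_scaleE scalerDl to_quotD.
Qed.

HB.instance Definition _ := GRing.Zmodule_isLmodule.Build K quotient_of
  quot_scaleA quot_scale1 quot_scaleDr quot_scaleDl.

Lemma to_quot_linear : linear to_quot.
Proof. by move=> a x y; rewrite to_quotD -quot_scaleE. Qed.

End QuotLmodule.
Arguments to_quot {K M} S x.

Definition is_bilinear (K : fieldType) (M N U : lmodType K) (f : M -> N -> U) :=
  bilinear_for *:%R *:%R f.

Lemma is_bilinearI (K : fieldType) (M N U : lmodType K) (f : M -> N -> U) :
  (forall a m m' n, f (a *: m + m') n = a *: f m n + f m' n) ->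
  (forall a m n n', f m (a *: n + n') = a *: f m n + f m n') -> is_bilinear f.
Proof. by move=> fl fr; split=> u a v w; [exact: fl | exact: fr]. Qed.

(** The tensor product: formal sums [m1(x)n1 + ... + mk(x)nk], represented by
    the list of the pairs [(mi, ni)], modulo the identities between such sums
    that hold under every bilinear map. *)
Section Tensor.
Context (K : fieldType) (M N : lmodType K).

Definition formal_eval (U : lmodType K) (f : M -> N -> U) (s : seq (M * N)) : U :=
  \sum_(p <- s) f p.1 p.2.

Definition formal_eq (s t : seq (M * N)) : bool :=
  `[< forall (U : lmodType K) (f : M -> N -> U),
        is_bilinear f -> formal_eval f s = formal_eval f t >].

Lemma formal_eq_equiv : equiv_class_of formal_eq.
Proof.
split=> [s|s t|t s r]; first exact/asboolP.
- by apply/asboolP/asboolP => e U f bf; rewrite e.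
- by move=> /asboolP st /asboolP tr; apply/asboolP => U f bf; rewrite st ?tr.
Qed.

Canonical formal_equiv := EquivRelPack formal_eq_equiv.
Canonical formal_encModRel := defaultEncModRel formal_eq.

Definition tensor : Type := {eq_quot formal_eq}.

HB.instance Definition _ := Choice.on tensor.

Definition tens (m : M) (n : N) : tensor := \pi_{eq_quot formal_eq} [:: (m, n)].

Definition tens_lift (U : lmodType K) (f : M -> N -> U) (u : tensor) : U :=
  formal_eval f (repr u).

Lemma tens_lift_pi (U : lmodType K) (f : M -> N -> U) s :
  is_bilinear f -> tens_lift f (\pi_{eq_quot formal_eq} s) = formal_eval f s.
Proof.
move=> bf; have /eqmodP/asboolP : repr (\pi_{eq_quot formal_eq} s) = s
  %[mod {eq_quot formal_eq}] by rewrite reprK.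
exact.
Qed.

Lemma tensor_eqP (u v : tensor) :
  (forall (U : lmodType K) (f : M -> N -> U),
     is_bilinear f -> tens_lift f u = tens_lift f v) -> u = v.
Proof.
move=> e; rewrite -[u]reprK -[v]reprK.
by apply/eqmodP/asboolP => U f bf; exact: e.
Qed.

Definition tensor_zero : tensor := \pi_{eq_quot formal_eq} [::].
Definition tensor_add (u v : tensor) : tensor :=
  \pi_{eq_quot formal_eq} (repr u ++ repr v).
Definition tensor_scale (a : K) (u : tensor) : tensor :=
  \pi_{eq_quot formal_eq} [seq (a *: p.1, p.2) | p <- repr u].
Definition tensor_opp (u : tensor) : tensor := tensor_scale (- 1) u.

Section LiftOp.
Context (U : lmodType K) (f : M -> N -> U) (bf : is_bilinear f).

Lemma lift_zero : tens_lift f tensor_zero = 0.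
Proof. by rewrite tens_lift_pi // /formal_eval big_nil. Qed.

Lemma lift_add u v : tens_lift f (tensor_add u v) = tens_lift f u + tens_lift f v.
Proof. by rewrite tens_lift_pi // /formal_eval big_cat. Qed.

Lemma lift_scale a u : tens_lift f (tensor_scale a u) = a *: tens_lift f u.
Proof.
rewrite tens_lift_pi // /formal_eval big_map scaler_sumr.
by apply: eq_bigr => p _; rewrite (scalable_linear (bf.1 p.2)).
Qed.

Lemma lift_opp u : tens_lift f (tensor_opp u) = - tens_lift f u.
Proof. by rewrite lift_scale scaleN1r. Qed.

End LiftOp.

Let liftE := (lift_zero, lift_add, lift_scale, lift_opp).

Lemma tensor_addA : associative tensor_add.
Proof. by move=> u v w; apply/tensor_eqP => U f bf; rewrite !liftE ?addrA. Qed.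
Lemma tensor_addC : commutative tensor_add.
Proof. by move=> u v; apply/tensor_eqP => U f bf; rewrite !liftE // addrC. Qed.
Lemma tensor_add0 : left_id tensor_zero tensor_add.
Proof. by move=> u; apply/tensor_eqP => U f bf; rewrite !liftE // add0r. Qed.
Lemma tensor_addN : left_inverse tensor_zero tensor_opp tensor_add.
Proof. by move=> u; apply/tensor_eqP => U f bf; rewrite !liftE // addNr. Qed.

HB.instance Definition _ := GRing.isZmodule.Build tensor
  tensor_addA tensor_addC tensor_add0 tensor_addN.

Lemma tensor_scaleA a b u :
  tensor_scale a (tensor_scale b u) = tensor_scale (a * b) u.
Proof. by apply/tensor_eqP => U f bf; rewrite !liftE // scalerA. Qed.
Lemma tensor_scale1 : left_id 1 tensor_scale.
Proof. by move=> u; apply/tensor_eqP => U f bf; rewrite !liftE // scale1r. Qed.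
Lemma tensor_scaleDr : right_distributive tensor_scale +%R.
Proof.
by move=> a u v; apply/tensor_eqP => U f bf; rewrite !liftE // scalerDr.
Qed.
Lemma tensor_scaleDl u : {morph tensor_scale^~ u : a b / a + b}.
Proof.
by move=> a b; apply/tensor_eqP => U f bf; rewrite !liftE // scalerDl.
Qed.

HB.instance Definition _ := GRing.Zmodule_isLmodule.Build K tensor
  tensor_scaleA tensor_scale1 tensor_scaleDr tensor_scaleDl.

Lemma tens_lift_linear (U : lmodType K) (f : M -> N -> U) :
  is_bilinear f -> linear (tens_lift f).
Proof. by move=> bf a u v; rewrite [LHS]lift_add // lift_scale. Qed.

Lemma tens_liftE (U : lmodType K) (f : M -> N -> U) m n :
  is_bilinear f -> tens_lift f (tens m n) = f m n.
Proof. by move=> bf; rewrite tens_lift_pi // /formal_eval big_seq1. Qed.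

Lemma tens_bilinear : is_bilinear tens.
Proof.
by split=> x a y z; apply/tensor_eqP => U f bf; rewrite [RHS]lift_add //
  lift_scale // !tens_liftE // (bf.1, bf.2).
Qed.

Lemma tensor_sum (u : tensor) : u = \sum_(p <- repr u) tens p.1 p.2.
Proof.
apply/tensor_eqP => U f bf; rewrite {1}/tens_lift /formal_eval.
elim: (repr u) => [|p s IH]; first by rewrite !big_nil lift_zero.
by rewrite !big_cons [RHS]lift_add // tens_liftE // IH.
Qed.

Lemma tensor_linear_ext (U : lmodType K) (f g : tensor -> U) :
  linear f -> linear g -> (forall m n, f (tens m n) = g (tens m n)) -> f =1 g.
Proof.
move=> lf lg e u; rewrite [u]tensor_sum.
have fE : f =1 linear_of lf by [].
have gE : g =1 linear_of lg by [].
by rewrite fE gE !linear_sum; apply: eq_bigr => p _; rewrite -fE -gE e.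
Qed.

End Tensor.

HB.mixin Record isLieAlgebra (K : fieldType) L of GRing.Lmodule K L := {
  lie_bracket : L -> L -> L;
  lie_bracket_bilinear : bilinear_for *:%R *:%R lie_bracket;
  lie_bracket_alt : forall x, lie_bracket x x = 0;
  lie_jacobi : forall x y z,
    lie_bracket x (lie_bracket y z) + lie_bracket y (lie_bracket z x)
      + lie_bracket z (lie_bracket x y) = 0
}.

#[short(type="lieAlgType")]
HB.structure Definition LieAlgebra (K : fieldType) :=
  {L of isLieAlgebra K L & GRing.Lmodule K L}.

Notation "[<| x , y |>]" := (lie_bracket x y)
  (at level 0, format "[<| x ,  y |>]") : ring_scope.

Record lie_subalgebra (K : fieldType) (L : lieAlgType K) := LieSubalgebra {
  lie_subalgebra_pred :> submodClosed L;
  lie_subalgebra_bracket : forall x y,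
    x \in lie_subalgebra_pred -> y \in lie_subalgebra_pred ->
    [<| x, y |>] \in lie_subalgebra_pred
}.

Section LieSub.
Context (K : fieldType) (L : lieAlgType K) (A : lie_subalgebra L).

Definition lie_sub : Type := subspace_of A.

HB.instance Definition _ := GRing.Lmodule.on lie_sub.

Definition lie_sub_val (x : lie_sub) : L := sval x.

Definition lie_sub_bracket (x y : lie_sub) : lie_sub :=
  exist _ [<| lie_sub_val x, lie_sub_val y |>]
    (lie_subalgebra_bracket (svalP x) (svalP y)).

Lemma lie_sub_val_linear : linear lie_sub_val. Proof. by []. Qed.

Lemma lie_sub_bracket_bilinear : bilinear_for *:%R *:%R lie_sub_bracket.
Proof.
split=> x a y z; apply/val_inj => /=.
  exact: (lie_bracket_bilinear (s := L)).1.
exact: (lie_bracket_bilinear (s := L)).2.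
Qed.
Lemma lie_sub_bracket_alt x : lie_sub_bracket x x = 0.
Proof. by apply/val_inj; exact: lie_bracket_alt. Qed.
Lemma lie_sub_jacobi x y z :
  lie_sub_bracket x (lie_sub_bracket y z)
  + lie_sub_bracket y (lie_sub_bracket z x)
  + lie_sub_bracket z (lie_sub_bracket x y) = 0.
Proof. by apply/val_inj; exact: lie_jacobi. Qed.

HB.instance Definition _ := isLieAlgebra.Build K lie_sub
  lie_sub_bracket_bilinear lie_sub_bracket_alt lie_sub_jacobi.

End LieSub.

Section Endo.
Context (K : fieldType) (V : lmodType K).

Definition endo : Type := {linear V -> V}.

HB.instance Definition _ := gen_eqMixin endo.
HB.instance Definition _ := gen_choiceMixin endo.

Definition endo_fun (f : endo) : V -> V := (f : {linear V -> V}).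
Coercion endo_fun : endo >-> Funclass.

Lemma endo_ext (f g : endo) : f =1 g -> f = g.
Proof. exact: linear_ext. Qed.

Definition endo_zero : endo := \0 : {linear V -> V}.
Definition endo_opp (f : endo) : endo :=
  (\- (f : {linear V -> V})) : {linear V -> V}.
Definition endo_add (f g : endo) : endo :=
  ((f : {linear V -> V}) \+ (g : {linear V -> V})) : {linear V -> V}.
Definition endo_scale (a : K) (f : endo) : endo :=
  (a \*: (f : {linear V -> V})) : {linear V -> V}.
Definition endo_comp (f g : endo) : endo :=
  ((f : {linear V -> V}) \o (g : {linear V -> V})) : {linear V -> V}.

Lemma endo_addA : associative endo_add.
Proof. by move=> f g h; apply: endo_ext => v; exact: addrA. Qed.
Lemma endo_addC : commutative endo_add.
Proof. by move=> f g; apply: endo_ext => v; exact: addrC. Qed.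
Lemma endo_add0 : left_id endo_zero endo_add.
Proof. by move=> f; apply: endo_ext => v; exact: add0r. Qed.
Lemma endo_addN : left_inverse endo_zero endo_opp endo_add.
Proof. by move=> f; apply: endo_ext => v; exact: addNr. Qed.

HB.instance Definition _ := GRing.isZmodule.Build endo
  endo_addA endo_addC endo_add0 endo_addN.

Lemma endo_scaleA a b f : endo_scale a (endo_scale b f) = endo_scale (a * b) f.
Proof. by apply: endo_ext => v; exact: scalerA. Qed.
Lemma endo_scale1 : left_id 1 endo_scale.
Proof. by move=> f; apply: endo_ext => v; exact: scale1r. Qed.
Lemma endo_scaleDr : right_distributive endo_scale +%R.
Proof. by move=> a f g; apply: endo_ext => v; exact: scalerDr. Qed.
Lemma endo_scaleDl f : {morph endo_scale^~ f : a b / a + b}.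
Proof. by move=> a b; apply: endo_ext => v; exact: scalerDl. Qed.

HB.instance Definition _ := GRing.Zmodule_isLmodule.Build K endo
  endo_scaleA endo_scale1 endo_scaleDr endo_scaleDl.

Definition endo_bracket (f g : endo) : endo := endo_comp f g - endo_comp g f.

Lemma endoDE (f g : endo) v : endo_fun (f + g) v = f v + g v. Proof. by []. Qed.
Lemma endoZE a (f : endo) v : endo_fun (a *: f) v = a *: f v. Proof. by []. Qed.
Lemma endo_bracketE (f g : endo) v : endo_bracket f g v = f (g v) - g (f v).
Proof. by []. Qed.
Lemma endo_appD (f : endo) : {morph f : u v / u + v}.
Proof. exact: raddfD. Qed.
Lemma endo_appN (f : endo) : {morph f : u / - u}.
Proof. exact: raddfN. Qed.
Lemma endo_appZ (f : endo) a : {morph f : u / a *: u}.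
Proof. exact: linearZ. Qed.

Lemma endo_bracket_linear_l h a f g :
  endo_bracket (a *: f + g) h = a *: endo_bracket f h + endo_bracket g h.
Proof.
apply: endo_ext => v; rewrite !(endo_bracketE, endoDE, endoZE).
by rewrite !(endo_appD, endo_appZ) scalerBr opprD addrACA.
Qed.
Lemma endo_bracket_linear_r h a f g :
  endo_bracket h (a *: f + g) = a *: endo_bracket h f + endo_bracket h g.
Proof.
apply: endo_ext => v; rewrite !(endo_bracketE, endoDE, endoZE).
by rewrite !(endo_appD, endo_appZ) scalerBr opprD addrACA.
Qed.
Lemma endo_bracket_bilinear : bilinear_for *:%R *:%R endo_bracket.
Proof.
by split=> h a f g; [exact: endo_bracket_linear_l | exact: endo_bracket_linear_r].
Qed.
Lemma endo_bracket_alt f : endo_bracket f f = 0.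
Proof. exact: subrr. Qed.
Lemma endo_jacobi f g h :
  endo_bracket f (endo_bracket g h) + endo_bracket g (endo_bracket h f)
  + endo_bracket h (endo_bracket f g) = 0.
Proof.
apply: endo_ext => v; rewrite !(endoDE, endo_bracketE) !(endo_appD, endo_appN).
have E (a b c d : V) : a - b - (c - d) = (a + d) - (c + b).
  by rewrite opprB addrACA -opprD [b + c]addrC.
by rewrite !E !subrKA subrr.
Qed.

HB.instance Definition _ := isLieAlgebra.Build K endo
  endo_bracket_bilinear endo_bracket_alt endo_jacobi.

End Endo.

Record lieModule (K : fieldType) (L : lieAlgType K) := LieModule {
  lie_module_sort :> lmodType K;
  lie_act : L -> lie_module_sort -> lie_module_sort;
  lie_act_bilinear : is_bilinear lie_act;
  lie_act_bracket : forall x y m,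
    lie_act [<| x, y |>] m
      = lie_act x (lie_act y m) - lie_act y (lie_act x m)
}.

Section LieActTheory.
Context (K : fieldType) (L : lieAlgType K) (N : lieModule L).

Lemma lie_act_linear x : linear (@lie_act K L N x).
Proof. exact: (lie_act_bilinear N).2. Qed.
Lemma lie_act_linear_l m : linear ((@lie_act K L N)^~ m).
Proof. exact: (lie_act_bilinear N).1. Qed.

Lemma lie_actD (x : L) (u v : N) : lie_act x (u + v) = lie_act x u + lie_act x v.
Proof. exact: (raddfD (linear_of (lie_act_linear x))). Qed.
Lemma lie_actN (x : L) (u : N) : lie_act x (- u) = - lie_act x u.
Proof. exact: (raddfN (linear_of (lie_act_linear x))). Qed.
Lemma lie_act0 (x : L) : lie_act x (0 : N) = 0.
Proof. exact: (raddf0 (linear_of (lie_act_linear x))). Qed.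
Lemma lie_actZ a (x : L) (u : N) : lie_act x (a *: u) = a *: lie_act x u.
Proof. exact: (scalable_linear (lie_act_linear x)). Qed.
Lemma lie_actP a (x : L) (u v : N) :
  lie_act x (a *: u + v) = a *: lie_act x u + lie_act x v.
Proof. by rewrite lie_actD lie_actZ. Qed.
Lemma lie_actPl a (x y : L) (u : N) :
  lie_act (a *: x + y) u = a *: lie_act x u + lie_act y u.
Proof. exact: lie_act_linear_l. Qed.

End LieActTheory.

Section LieModules.
Context (K : fieldType) (L : lieAlgType K).
Implicit Types M N : lieModule L.

Record lie_hom M N := LieHom {
  lie_hom_fun :> {linear M -> N};
  lie_hom_act : forall (x : L) (m : M),
    lie_hom_fun (lie_act x m) = lie_act x (lie_hom_fun m)
}.

Lemma lie_hom_ext M N (f g : lie_hom M N) : f =1 g -> f = g.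
Proof.
case: f g => f ef [g eg] /= /linear_ext fg; case: _ / fg in eg *.
by rewrite (Prop_irrelevance ef eg).
Qed.

Definition lie_hom_of M N (f : M -> N) (lf : linear f)
    (ef : forall (x : L) m, f (lie_act x m) = lie_act x (f m)) : lie_hom M N :=
  @LieHom M N (linear_of lf) ef.

Definition lie_isomorphic M N : Prop :=
  exists (f : lie_hom M N) (g : lie_hom N M), cancel f g /\ cancel g f.

Lemma lie_id_linear M : linear (@id M). Proof. by []. Qed.
Definition lie_id M : lie_hom M M := lie_hom_of (@lie_id_linear M) (fun _ _ => erefl).

Lemma lie_comp_linear M N P (g : lie_hom N P) (f : lie_hom M N) :
  linear (g \o f).
Proof. by move=> a u v /=; rewrite !linearP. Qed.
Lemma lie_comp_act M N P (g : lie_hom N P) (f : lie_hom M N) x m :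
  (g \o f) (lie_act x m) = lie_act x ((g \o f) m).
Proof. by rewrite /= !lie_hom_act. Qed.
Definition lie_comp M N P (g : lie_hom N P) (f : lie_hom M N) : lie_hom M P :=
  lie_hom_of (lie_comp_linear g f) (lie_comp_act g f).

Definition triv_act (x : L) (c : K^o) : K^o := 0.
Lemma triv_act_bilinear : is_bilinear triv_act.
Proof. by split=> x a u v /=; rewrite /triv_act scaler0 addr0. Qed.
Lemma triv_act_bracket (x y : L) c :
  triv_act [<| x, y |>] c = triv_act x (triv_act y c) - triv_act y (triv_act x c).
Proof. by rewrite /triv_act subrr. Qed.
Definition triv_module : lieModule L :=
  @LieModule K L K^o triv_act triv_act_bilinear triv_act_bracket.

Section DirectSum2.
Variables M N : lieModule L.
Definition dsum2_act (x : L) (u : M * N) : M * N := (lie_act x u.1, lie_act x u.2).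
Lemma dsum2_act_bilinear : is_bilinear dsum2_act.
Proof.
by split=> x a u v; rewrite /dsum2_act /= ?lie_actP ?lie_actPl.
Qed.
Lemma dsum2_act_bracket x y u :
  dsum2_act [<| x, y |>] u = dsum2_act x (dsum2_act y u) - dsum2_act y (dsum2_act x u).
Proof. by rewrite /dsum2_act !lie_act_bracket. Qed.
Definition dsum2 : lieModule L := LieModule dsum2_act_bilinear dsum2_act_bracket.
End DirectSum2.

Section Submodules.
Variable M : lieModule L.

Record submodule := Submodule {
  submodule_pred :> submodClosed M;
  submodule_act : forall (x : L) m,
    m \in submodule_pred -> lie_act x m \in submodule_pred
}.

Variable S : submodule.

Definition sub_act (x : L) (m : subspace_of S) : subspace_of S :=
  exist _ (lie_act x (sval m)) (submodule_act x (svalP m)).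
Lemma sub_act_bilinear : is_bilinear sub_act.
Proof.
by split=> x a u v; apply/val_inj; [exact: lie_actPl | exact: lie_actP].
Qed.
Lemma sub_act_bracket x y m :
  sub_act [<| x, y |>] m = sub_act x (sub_act y m) - sub_act y (sub_act x m).
Proof. by apply/val_inj; exact: lie_act_bracket. Qed.
Definition sub_module : lieModule L := LieModule sub_act_bilinear sub_act_bracket.

Definition quot_act (x : L) (u : quotient_of S) : quotient_of S :=
  to_quot S (lie_act x (repr u)).
Lemma quot_actE x m : quot_act x (to_quot S m) = to_quot S (lie_act x m).
Proof.
apply/to_quotP; rewrite -lie_actN -lie_actD submodule_act //.
by apply/to_quotP; rewrite /to_quot reprK.
Qed.
Lemma quot_act_bilinear : is_bilinear quot_act.
Proof.
split=> [m a x y|x a]; first by elim/to_quotW: m => m /=; rewrite !quot_actE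
  lie_actPl to_quot_linear.
elim/to_quotW => u; elim/to_quotW => v.
by rewrite -to_quot_linear !quot_actE lie_actP to_quot_linear.
Qed.
Lemma quot_act_bracket x y m :
  quot_act [<| x, y |>] m = quot_act x (quot_act y m) - quot_act y (quot_act x m).
Proof.
elim/to_quotW: m => m; rewrite !quot_actE lie_act_bracket.
exact: (raddfB (linear_of (@to_quot_linear _ _ S))).
Qed.
Definition quot_module : lieModule L :=
  LieModule quot_act_bilinear quot_act_bracket.

End Submodules.

Definition is_subquotient M (X : lieModule L) : Prop :=
  exists (S : submodule X) (S' : submodule (sub_module S)),
    lie_isomorphic M (quot_module S').

Definition is_zero_module M : Prop := forall m : M, m = 0.

Definition is_simple M : Prop :=
  ~ is_zero_module M /\
  forall S : submodule M, (forall m, m \in S -> m = 0) \/ (forall m, m \in S).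

(** Existence of a composition series, by recursion on its length. *)
Inductive finite_length : lieModule L -> Prop :=
| FiniteLengthZero M : is_zero_module M -> finite_length M
| FiniteLengthStep M (S : submodule M) :
    finite_length (sub_module S) -> is_simple (quot_module S) -> finite_length M.

End LieModules.

Section DirectSum.
Context (K : fieldType) (L : lieAlgType K) (I : eqType) (M : I -> lieModule L).

Definition lie_family : Type := forall i, M i.

HB.instance Definition _ := gen_eqMixin lie_family.
HB.instance Definition _ := gen_choiceMixin lie_family.

Definition lie_family_zero : lie_family := fun i => 0.
Definition lie_family_opp (f : lie_family) : lie_family := fun i => - f i.
Definition lie_family_add (f g : lie_family) : lie_family := fun i => f i + g i.
Definition lie_family_scale (a : K) (f : lie_family) : lie_family := fun i => a *: f i.

Lemma lie_family_addA : associative lie_family_add.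
Proof. by move=> f g h; apply: functional_extensionality_dep => i; exact: addrA. Qed.
Lemma lie_family_addC : commutative lie_family_add.
Proof. by move=> f g; apply: functional_extensionality_dep => i; exact: addrC. Qed.
Lemma lie_family_add0 : left_id lie_family_zero lie_family_add.
Proof. by move=> f; apply: functional_extensionality_dep => i; exact: add0r. Qed.
Lemma lie_family_addN : left_inverse lie_family_zero lie_family_opp lie_family_add.
Proof. by move=> f; apply: functional_extensionality_dep => i; exact: addNr. Qed.

HB.instance Definition _ := GRing.isZmodule.Build lie_family
  lie_family_addA lie_family_addC lie_family_add0 lie_family_addN.

Lemma lie_family_scaleA a b f :
  lie_family_scale a (lie_family_scale b f) = lie_family_scale (a * b) f.
Proof. by apply: functional_extensionality_dep => i; exact: scalerA. Qed.
Lemma lie_family_scale1 : left_id 1 lie_family_scale.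
Proof. by move=> f; apply: functional_extensionality_dep => i; exact: scale1r. Qed.
Lemma lie_family_scaleDr : right_distributive lie_family_scale +%R.
Proof. by move=> a f g; apply: functional_extensionality_dep => i; exact: scalerDr. Qed.
Lemma lie_family_scaleDl f : {morph lie_family_scale^~ f : a b / a + b}.
Proof. by move=> a b; apply: functional_extensionality_dep => i; exact: scalerDl. Qed.

HB.instance Definition _ := GRing.Zmodule_isLmodule.Build K lie_family
  lie_family_scaleA lie_family_scale1 lie_family_scaleDr lie_family_scaleDl.

Definition finsupp : {pred lie_family} :=
  fun f => `[< exists s : seq I, forall i, i \notin s -> f i = 0 >].

Lemma finsupp_closed : GRing.submod_closed finsupp.
Proof.
split; first by apply/asboolP; exists [::].
move=> a f g /asboolP[s fs] /asboolP[t gt]; apply/asboolP; exists (s ++ t) => i.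
rewrite mem_cat negb_or => /andP[/fs fi /gt gi].
by rewrite -[LHS]/(a *: f i + g i) fi gi scaler0 addr0.
Qed.

HB.instance Definition _ := GRing.isSubmodClosed.Build K lie_family finsupp
  finsupp_closed.

Definition lie_family_act (x : L) (f : lie_family) : lie_family := fun i => lie_act x (f i).

Lemma family_act_bilinear : is_bilinear lie_family_act.
Proof.
split=> [f a x y|x a f g]; apply: functional_extensionality_dep => i.
  exact: lie_actPl.
exact: lie_actP.
Qed.

Lemma family_act_bracket x y f :
  lie_family_act [<| x, y |>] f
    = lie_family_act x (lie_family_act y f) - lie_family_act y (lie_family_act x f).
Proof. by apply: functional_extensionality_dep => i; exact: lie_act_bracket. Qed.

Definition lie_family_module : lieModule L :=
  LieModule family_act_bilinear family_act_bracket.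

Lemma family_act_finsupp (x : L) (f : lie_family_module) :
  f \in finsupp -> lie_act x f \in finsupp.
Proof.
move=> /asboolP[s fs]; apply/asboolP; exists s => i /fs fi.
by rewrite -[LHS]/(lie_act x (f i)) fi lie_act0.
Qed.

Definition dsum : lieModule L :=
  sub_module (@Submodule K L lie_family_module finsupp family_act_finsupp).

End DirectSum.

Section TensorModule.
Context (K : fieldType) (L : lieAlgType K) (M N : lieModule L).

Definition tensor_act_pair (x : L) (m : M) (n : N) : tensor M N :=
  tens (lie_act x m) n + tens m (lie_act x n).

Lemma tensPl a (m m' : M) (n : N) : tens (a *: m + m') n = a *: tens m n + tens m' n.
Proof. exact: (tens_bilinear M N).1. Qed.
Lemma tensPr a (m : M) (n n' : N) : tens m (a *: n + n') = a *: tens m n + tens m n'.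
Proof. exact: (tens_bilinear M N).2. Qed.

Lemma tensor_act_pair_bilinear x : is_bilinear (tensor_act_pair x).
Proof.
apply: is_bilinearI => a u v w; rewrite /tensor_act_pair lie_actP.
  by rewrite !tensPl scalerDr addrACA.
by rewrite !tensPr scalerDr addrACA.
Qed.

Definition tensor_act (x : L) : tensor M N -> tensor M N :=
  tens_lift (tensor_act_pair x).

Lemma tensor_actE x m n :
  tensor_act x (tens m n) = tens (lie_act x m) n + tens m (lie_act x n).
Proof. by rewrite /tensor_act tens_liftE //; exact: tensor_act_pair_bilinear. Qed.

Lemma tensor_act_linear x : linear (tensor_act x).
Proof. exact/tens_lift_linear/tensor_act_pair_bilinear. Qed.

Lemma tensor_actD x : {morph tensor_act x : u v / u + v}.
Proof. exact: (raddfD (linear_of (tensor_act_linear x))). Qed.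

Lemma tensor_act_linear_l u : linear (tensor_act^~ u).
Proof.
move=> a x y; pose f v := tensor_act (a *: x + y) v.
pose g v := a *: tensor_act x v + tensor_act y v.
rewrite -[LHS]/(f u) -[RHS]/(g u); apply: tensor_linear_ext u.
- exact: tensor_act_linear.
- move=> b u v; rewrite /g !tensor_act_linear !scalerDr !scalerA [a * b]mulrC.
  by rewrite addrACA.
- move=> m n; rewrite /f /g !tensor_actE !lie_actPl tensPl tensPr scalerDr.
  by rewrite addrACA.
Qed.

Lemma tensor_act_bilinear : is_bilinear tensor_act.
Proof. by split; [exact: tensor_act_linear_l | exact: tensor_act_linear]. Qed.

Lemma tensBl (m m' : M) (n : N) : tens (m - m') n = tens m n - tens m' n.
Proof. by rewrite addrC -scaleN1r tensPl scaleN1r addrC. Qed.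
Lemma tensBr (m : M) (n n' : N) : tens m (n - n') = tens m n - tens m n'.
Proof. by rewrite addrC -scaleN1r tensPr scaleN1r addrC. Qed.

Lemma tensor_act_bracket x y u :
  tensor_act [<| x, y |>] u
    = tensor_act x (tensor_act y u) - tensor_act y (tensor_act x u).
Proof.
pose g v := tensor_act x (tensor_act y v) - tensor_act y (tensor_act x v).
rewrite -[RHS]/(g u); apply: tensor_linear_ext u.
- exact: tensor_act_linear.
- move=> b u v; rewrite /g !tensor_act_linear scalerBr opprD.
  by rewrite addrACA.
- move=> m n; rewrite /g !tensor_actE !tensor_actD !tensor_actE.
  rewrite !lie_act_bracket tensBl tensBr.
  have E (a b c d e f : tensor M N) :
      a + e + (f + c) - (b + f + (e + d)) = a - b + (c - d).
    rewrite [f + c]addrC [e + d]addrC addrACA [b + f + _]addrACA [f + e]addrC.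
    by rewrite opprD (addrACA (a + c)) subrr addr0 opprD addrACA.
  by rewrite E.
Qed.

Definition tensor_module : lieModule L :=
  LieModule tensor_act_bilinear tensor_act_bracket.

Lemma lie_act_tens (x : L) (m : M) (n : N) :
  lie_act x (tens m n : tensor_module)
    = tens (lie_act x m) n + tens m (lie_act x n).
Proof. exact: tensor_actE. Qed.

End TensorModule.

Section TensorAlgebra.
Context (K : fieldType) (L : lieAlgType K) (N : lieModule L).

Fixpoint tensor_power (n : nat) : lieModule L :=
  if n is n'.+1 then tensor_module N (tensor_power n') else triv_module L.

(** Only the module structure of the tensor algebra [T(N)] is needed. *)
Definition tensor_algebra : lieModule L := dsum tensor_power.

Definition tensor_algebra_sum (n : nat) : lieModule L :=
  dsum (fun _ : 'I_n => tensor_algebra).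

Definition tensor_category_obj (M : lieModule L) : Prop :=
  finite_length M /\
  exists n : nat, (0 < n)%N /\ is_subquotient M (tensor_algebra_sum n).

End TensorAlgebra.

Section Restriction.
Context (K : fieldType) (L : lieAlgType K) (A : lie_subalgebra L).
Variable N : lieModule L.

Definition restrict_act (x : lie_sub A) (m : N) : N := lie_act (lie_sub_val x) m.
Lemma restrict_act_bilinear : is_bilinear restrict_act.
Proof.
by apply: is_bilinearI => a u v w; [exact: lie_actPl | exact: lie_actP].
Qed.
Lemma restrict_act_bracket (x y : lie_sub A) m :
  restrict_act [<| x, y |>] m
    = restrict_act x (restrict_act y m) - restrict_act y (restrict_act x m).
Proof. exact: lie_act_bracket. Qed.
Definition lie_restrict : lieModule (lie_sub A) :=
  LieModule restrict_act_bilinear restrict_act_bracket.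

Definition acts_densely : Prop :=
  forall (s : seq N) (x : L),
    exists2 y : L, y \in A & forall r, r \in s -> lie_act y r = lie_act x r.

End Restriction.

Definition infinite_dim (K : fieldType) (V : lmodType K) : Prop :=
  ~ exists (n : nat) (e : 'I_n -> V),
      forall v, exists c : 'I_n -> K, v = \sum_i c i *: e i.

Definition nondegenerate_pairing (K : fieldType) (V W : lmodType K)
    (p : {bilinear V -> W -> K | *%R & *%R}) : Prop :=
  (forall v, (forall w, p v w = 0) -> v = 0) /\
  (forall w, (forall v, p v w = 0) -> w = 0).

Section GL.
Context (K : fieldType) (V W : lmodType K).
Variable p : {bilinear V -> W -> K | *%R & *%R}.

(** [phi^* (W) <= W], where [W] is identified with the functionals [p ^~ w]. *)
Definition preserves_dual (phi : endo V) : Prop :=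
  forall w, exists w', forall v, p (phi v) w = p v w'.

Definition glM_pred : {pred endo V} := fun phi => `[< preserves_dual phi >].

Lemma glM_closed : GRing.submod_closed glM_pred.
Proof.
split; first by apply/asboolP => w; exists 0 => v; rewrite linear0r linear0l.
move=> a f g /asboolP pf /asboolP pg; apply/asboolP => w.
have [w1 e1] := pf w; have [w2 e2] := pg w.
exists (a *: w1 + w2) => v.
by rewrite endoDE endoZE linearPl linearPr e1 e2.
Qed.

HB.instance Definition _ := GRing.isSubmodClosed.Build K (endo V) glM_pred
  glM_closed.

Lemma glM_bracket (f g : endo V) :
  f \in glM_pred -> g \in glM_pred -> [<| f, g |>] \in glM_pred.
Proof.
move=> /asboolP pf /asboolP pg; apply/asboolP => w.
have [w1 e1] := pf w; have [w2 e2] := pg w.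
have [w12 e12] := pf w2; have [w21 e21] := pg w1.
exists (w21 - w12) => v.
by rewrite endo_bracketE linearBl linearBr e1 e2 e12 e21.
Qed.

Definition glM : lie_subalgebra (endo V) :=
  @LieSubalgebra K (endo V) glM_pred glM_bracket.

End GL.

(** [isoM p] is [o^M(V)] when [p] is symmetric and [sp^M(V)] when [p] is
    antisymmetric. *)
Section Iso.
Context (K : fieldType) (V : lmodType K).
Variable p : {bilinear V -> V -> K | *%R & *%R}.

Definition isoM_pred : {pred endo V} :=
  fun X => `[< forall v w, p (X v) w + p v (X w) = 0 >].

Lemma isoM_closed : GRing.submod_closed isoM_pred.
Proof.
split; first by apply/asboolP => v w; rewrite linear0r linear0l addr0.
move=> a f g /asboolP pf /asboolP pg; apply/asboolP => v w.
by rewrite !(endoDE, endoZE) linearPl linearPr addrACA -mulrDr pf pg mulr0 addr0.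
Qed.

HB.instance Definition _ := GRing.isSubmodClosed.Build K (endo V) isoM_pred
  isoM_closed.

Lemma isoM_bracket (f g : endo V) :
  f \in isoM_pred -> g \in isoM_pred -> [<| f, g |>] \in isoM_pred.
Proof.
move=> /asboolP pf /asboolP pg; apply/asboolP => v w.
have ef u u' : p (f u) u' = - p u (f u') by apply/eqP; rewrite -addr_eq0 pf.
have eg u u' : p (g u) u' = - p u (g u') by apply/eqP; rewrite -addr_eq0 pg.
have H : p (f (g v)) w - p (g (f v)) w + (p v (f (g w)) - p v (g (f w))) = 0.
  by rewrite ef eg eg ef !opprK addrC subrKA subrr.
by rewrite !endo_bracketE linearBl linearBr; exact: H.
Qed.

Definition isoM : lie_subalgebra (endo V) :=
  @LieSubalgebra K (endo V) isoM_pred isoM_bracket.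

End Iso.

Section NaturalModules.
Context (K : fieldType) (V : lmodType K) (A : lie_subalgebra (endo V)).

Definition sub_endo (x : lie_sub A) : endo V := lie_sub_val x.

Lemma sub_endo_linear : linear sub_endo. Proof. by []. Qed.

Definition natural_act (x : lie_sub A) (v : V) : V := sub_endo x v.
Lemma natural_act_bilinear : is_bilinear natural_act.
Proof.
apply: is_bilinearI => // a x u v.
exact: (linearP (sub_endo x : {linear V -> V})).
Qed.
Lemma natural_act_bracket (x y : lie_sub A) v :
  natural_act [<| x, y |>] v
    = natural_act x (natural_act y v) - natural_act y (natural_act x v).
Proof. by []. Qed.
Definition natural_module : lieModule (lie_sub A) :=
  LieModule natural_act_bilinear natural_act_bracket.

End NaturalModules.

Section DualModule.
Context (K : fieldType) (V W : lmodType K).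
Variable p : {bilinear V -> W -> K | *%R & *%R}.
Hypothesis nd : nondegenerate_pairing p.

Lemma glM_preserves_dual (x : lie_sub (glM p)) : preserves_dual p (sub_endo x).
Proof. exact/asboolP/(svalP x). Qed.

Definition transpose (x : lie_sub (glM p)) (w : W) : W :=
  sval (cid (glM_preserves_dual x w)).

Lemma transposeP x w v : p (sub_endo x v) w = p v (transpose x w).
Proof. exact: (svalP (cid (glM_preserves_dual x w))). Qed.

Lemma pairing_inj w w' : (forall v, p v w = p v w') -> w = w'.
Proof.
move=> e; apply/eqP; rewrite -subr_eq0; apply/eqP/nd.2 => v.
by rewrite linearBr e subrr.
Qed.

(** [transpose x] is the restriction to [W] of the adjoint [x^*]. *)
Definition dual_act (x : lie_sub (glM p)) (w : W) : W := - transpose x w.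

Lemma dual_actP x w v : p v (dual_act x w) = - p (sub_endo x v) w.
Proof. by rewrite linearNr transposeP. Qed.

Lemma dual_act_bilinear : is_bilinear dual_act.
Proof.
apply: is_bilinearI => a u v w; apply: pairing_inj => z.
  rewrite dual_actP linearPr !dual_actP sub_endo_linear endoDE endoZE.
  by rewrite linearPl opprD mulrN.
by rewrite linearPr !dual_actP linearPr opprD mulrN.
Qed.

Lemma dual_act_bracket x y w :
  dual_act [<| x, y |>] w = dual_act x (dual_act y w) - dual_act y (dual_act x w).
Proof.
apply: pairing_inj => v; rewrite linearBr !dual_actP !opprK.
by rewrite -[sub_endo _]/(endo_bracket _ _) endo_bracketE linearBl opprB.
Qed.

Definition dual_module : lieModule (lie_sub (glM p)) :=
  LieModule dual_act_bilinear dual_act_bracket.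

End DualModule.

Inductive mackey_data (K : fieldType) : Type :=
| MackeyGL (V W : lmodType K) (p : {bilinear V -> W -> K | *%R & *%R})
    of infinite_dim V & infinite_dim W & nondegenerate_pairing p
| MackeyO (V : lmodType K) (p : {bilinear V -> V -> K | *%R & *%R})
    of infinite_dim V & nondegenerate_pairing p & (forall v w, p v w = p w v)
| MackeySp (V : lmodType K) (p : {bilinear V -> V -> K | *%R & *%R})
    of infinite_dim V & nondegenerate_pairing p & (forall v w, p v w = - p w v).

Definition mackey_lie (K : fieldType) (d : mackey_data K) : lieAlgType K :=
  match d with
  | MackeyGL V W p _ _ _ => lie_sub (glM p)
  | MackeyO V p _ _ _ => lie_sub (isoM p)
  | MackeySp V p _ _ _ => lie_sub (isoM p)
  end.

Definition mackey_module (K : fieldType) (d : mackey_data K) :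
    lieModule (mackey_lie d) :=
  match d with
  | MackeyGL V W p _ _ nd => dsum2 (natural_module (glM p)) (dual_module nd)
  | MackeyO V p _ _ _ => natural_module (isoM p)
  | MackeySp V p _ _ _ => natural_module (isoM p)
  end.

Record category := Category {
  cat_obj :> Type;
  hom : cat_obj -> cat_obj -> Type;
  idm : forall a, hom a a;
  compm : forall a b c, hom b c -> hom a b -> hom a c;
  compm1l : forall a b (f : hom a b), compm (idm b) f = f;
  compm1r : forall a b (f : hom a b), compm f (idm a) = f;
  compmA : forall a b c d (h : hom c d) (g : hom b c) (f : hom a b),
    compm h (compm g f) = compm (compm h g) f
}.
Arguments hom {c0}.
Arguments idm {c0}.
Arguments compm {c0 a b c}.

Declare Scope cat_scope.
Delimit Scope cat_scope with cat.
Local Open Scope cat_scope.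
(** Composition in diagrammatic order: [f] first, then [g]. *)
Notation "f \; g" := (compm g f) : cat_scope.

Definition is_iso (C : category) (a b : C) (f : hom a b) : Prop :=
  exists g : hom b a, f \; g = idm a /\ g \; f = idm b.

Record functor (C D : category) := Functor {
  fobj :> C -> D;
  fmap : forall a b : C, hom a b -> hom (fobj a) (fobj b);
  fmap1 : forall a, fmap (idm a) = idm (fobj a);
  fmapM : forall a b c (f : hom a b) (g : hom b c),
    fmap (f \; g) = fmap f \; fmap g
}.

(** Functors enter through their actions on objects and morphisms, so that the
    identity and composite functors need not be packaged. *)
Definition nat_isomorphic (C D : category) (Fo Go : C -> D)
    (Fm : forall a b, hom a b -> hom (Fo a) (Fo b))
    (Gm : forall a b, hom a b -> hom (Go a) (Go b)) : Prop :=
  exists eta : forall a, hom (Fo a) (Go a),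
    (forall a, is_iso (eta a)) /\
    (forall a b (f : hom a b), Fm a b f \; eta b = eta a \; Gm a b f).

Definition is_equivalence (C D : category) (F : functor C D) : Prop :=
  exists G : functor D C,
    nat_isomorphic (fun a b (f : hom a b) => f) (fun a b f => fmap G (fmap F f)) /\
    nat_isomorphic (fun a b f => fmap F (fmap G f)) (fun a b (f : hom a b) => f).

Record monoidal_category := MonoidalCategory {
  mcat :> category;
  munit : mcat;
  mprod : mcat -> mcat -> mcat;
  mprodm : forall a a' b b' : mcat,
    hom a a' -> hom b b' -> hom (mprod a b) (mprod a' b');
  mprodm1 : forall a b, mprodm (idm a) (idm b) = idm (mprod a b);
  mprodmM : forall a a' a'' b b' b'' (f : hom a a') (f' : hom a' a'')
      (g : hom b b') (g' : hom b' b''),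
    mprodm (f \; f') (g \; g') = mprodm f g \; mprodm f' g';
  massoc : forall a b c, hom (mprod (mprod a b) c) (mprod a (mprod b c));
  massoc_iso : forall a b c, is_iso (massoc a b c);
  massoc_nat : forall a a' b b' c c' (f : hom a a') (g : hom b b') (h : hom c c'),
    mprodm (mprodm f g) h \; massoc a' b' c'
      = massoc a b c \; mprodm f (mprodm g h);
  mlunit : forall a, hom (mprod munit a) a;
  mlunit_iso : forall a, is_iso (mlunit a);
  mlunit_nat : forall a b (f : hom a b),
    mprodm (idm munit) f \; mlunit b = mlunit a \; f;
  mrunit : forall a, hom (mprod a munit) a;
  mrunit_iso : forall a, is_iso (mrunit a);
  mrunit_nat : forall a b (f : hom a b),
    mprodm f (idm munit) \; mrunit b = mrunit a \; f;
  mpentagon : forall a b c d,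
    mprodm (massoc a b c) (idm d) \; massoc a (mprod b c) d
        \; mprodm (idm a) (massoc b c d)
      = massoc (mprod a b) c d \; massoc a b (mprod c d);
  mtriangle : forall a b,
    massoc a munit b \; mprodm (idm a) (mlunit b) = mprodm (mrunit a) (idm b)
}.
Arguments munit {m}.
Arguments mprod {m}.
Arguments mprodm {m a a' b b'}.
Arguments massoc {m}.
Arguments mlunit {m}.
Arguments mrunit {m}.

Record monoidal_functor (C D : monoidal_category) := MonoidalFunctor {
  mfunctor :> functor C D;
  mf_unit : hom munit (mfunctor munit);
  mf_unit_iso : is_iso mf_unit;
  mf_prod : forall a b : C,
    hom (mprod (mfunctor a) (mfunctor b)) (mfunctor (mprod a b));
  mf_prod_iso : forall a b, is_iso (mf_prod a b);
  mf_prod_nat : forall (a a' b b' : C) (f : hom a a') (g : hom b b'),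
    mprodm (fmap mfunctor f) (fmap mfunctor g) \; mf_prod a' b'
      = mf_prod a b \; fmap mfunctor (mprodm f g);
  mf_assoc : forall a b c : C,
    mprodm (mf_prod a b) (idm (mfunctor c)) \; mf_prod (mprod a b) c
        \; fmap mfunctor (massoc a b c)
      = massoc (mfunctor a) (mfunctor b) (mfunctor c)
        \; mprodm (idm (mfunctor a)) (mf_prod b c) \; mf_prod a (mprod b c);
  mf_lunit : forall a : C,
    mprodm mf_unit (idm (mfunctor a)) \; mf_prod munit a
        \; fmap mfunctor (mlunit a)
      = mlunit (mfunctor a);
  mf_runit : forall a : C,
    mprodm (idm (mfunctor a)) mf_unit \; mf_prod a munit
        \; fmap mfunctor (mrunit a)
      = mrunit (mfunctor a)
}.

Definition monoidally_equivalent (C D : monoidal_category) : Prop :=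
  exists F : monoidal_functor C D, is_equivalence F.

Section FullSubcategory.
Variables (C : monoidal_category) (P : C -> Prop).

Definition monoidally_closed : Prop :=
  P munit /\ forall a b, P a -> P b -> P (mprod a b).

Definition full_obj : Type := {a : C | P a}.

Definition full_subcategory : category := {|
  cat_obj := full_obj;
  hom := fun a b : full_obj => hom (sval a) (sval b);
  idm := fun a => idm (sval a);
  compm := fun a b c g f => compm g f;
  compm1l := fun a b f => compm1l f;
  compm1r := fun a b f => compm1r f;
  compmA := fun a b c d h g f => compmA h g f |}.

Hypothesis Pclosed : monoidally_closed.

Definition full_unit : full_subcategory := exist P munit Pclosed.1.
Definition full_prod (a b : full_subcategory) : full_subcategory :=
  exist P (mprod (sval a) (sval b)) (Pclosed.2 _ _ (svalP a) (svalP b)).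

(** The full subcategory on the objects satisfying [P], with the monoidal
    structure of [C] (which requires [P] to be closed under it). *)
Definition full_monoidal_subcategory : monoidal_category :=
  @MonoidalCategory full_subcategory full_unit full_prod
    (fun a a' b b' f g => @mprodm C _ _ _ _ f g)
    (fun a b => @mprodm1 C _ _)
    (fun a a' a'' b b' b'' f f' g g' => @mprodmM C _ _ _ _ _ _ f f' g g')
    (fun a b c => @massoc C _ _ _)
    (fun a b c => @massoc_iso C _ _ _)
    (fun a a' b b' c c' f g h => @massoc_nat C _ _ _ _ _ _ f g h)
    (fun a => @mlunit C _)
    (fun a => @mlunit_iso C _)
    (fun a b f => @mlunit_nat C _ _ f)
    (fun a => @mrunit C _)
    (fun a => @mrunit_iso C _)
    (fun a b f => @mrunit_nat C _ _ f)
    (fun a b c d => @mpentagon C _ _ _ _)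
    (fun a b => @mtriangle C _ _).

End FullSubcategory.

Section TensorMaps.
Context (K : fieldType) (L : lieAlgType K).
Implicit Types M N P : lieModule L.

Lemma tensor_hom_ext M N P (f g : lie_hom (tensor_module M N) P) :
  (forall m n, f (tens m n) = g (tens m n)) -> f = g.
Proof.
move=> e; apply/lie_hom_ext/tensor_linear_ext => //; exact: linearP.
Qed.

Lemma tensor_hom3_ext M N P Q (f g : lie_hom (tensor_module (tensor_module M N) P) Q) :
  (forall m n p, f (tens (tens m n) p) = g (tens (tens m n) p)) -> f = g.
Proof.
move=> e; apply: tensor_hom_ext => u p.
apply: (@tensor_linear_ext K M N Q (fun u => f (tens u p)) (fun u => g (tens u p))).
- by move=> a v w; rewrite (@tensPl K L (tensor_module M N)) linearP.
- by move=> a v w; rewrite (@tensPl K L (tensor_module M N)) linearP.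
- by move=> m n; exact: e.
Qed.

Lemma tensor_hom4_ext M N P Q S
    (f g : lie_hom (tensor_module (tensor_module (tensor_module M N) P) Q) S) :
  (forall m n p q, f (tens (tens (tens m n) p) q) = g (tens (tens (tens m n) p) q)) ->
  f = g.
Proof.
move=> e; apply: tensor_hom_ext => u q.
apply: (@tensor_linear_ext K _ P S (fun u => f (tens u q)) (fun u => g (tens u q))).
- by move=> a v w; rewrite (@tensPl K L (tensor_module _ P)) linearP.
- by move=> a v w; rewrite (@tensPl K L (tensor_module _ P)) linearP.
have lin (h : lie_hom (tensor_module (tensor_module (tensor_module M N) P) Q) S) p :
    linear (fun u : tensor M N => h (tens (tens u p) q)).
  move=> a v w; etransitivity; last exact: linearP.
  congr (h _); etransitivity; last exact: (@tensPl K L (tensor_module _ P)).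
  by congr tens; exact: (@tensPl K L (tensor_module M N)).
move=> {}u p; apply: (tensor_linear_ext (lin f p) (lin g p)) => m n; exact: e.
Qed.

Lemma tensor_hom3r_ext M N P Q (f g : lie_hom (tensor_module M (tensor_module N P)) Q) :
  (forall m n p, f (tens m (tens n p)) = g (tens m (tens n p))) -> f = g.
Proof.
move=> e; apply: tensor_hom_ext => m u.
have lin (h : lie_hom (tensor_module M (tensor_module N P)) Q) :
    linear (fun u : tensor N P => h (tens m u)).
  move=> a v w; etransitivity; last exact: linearP.
  by congr (h _); exact: (@tensPr K L M (tensor_module N P)).
apply: (tensor_linear_ext (lin f) (lin g)) => n p; exact: e.
Qed.

Section Lift.
Variables (M N P : lieModule L) (f : M -> N -> P) (bf : is_bilinear f).
Hypothesis ef : forall (x : L) m n,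
  f (lie_act x m) n + f m (lie_act x n) = lie_act x (f m n).

Lemma tens_lift_act (x : L) (u : tensor_module M N) :
  tens_lift f (lie_act x u) = lie_act x (tens_lift f u).
Proof.
have lf := tens_lift_linear bf.
have E := @tensor_linear_ext K M N P (fun u => tens_lift f (tensor_act x u))
  (fun u => lie_act x (tens_lift f u)); apply: E => {u}.
- by move=> a u v; rewrite tensor_act_linear lf.
- by move=> a u v; rewrite lf lie_actP.
- move=> m n; rewrite tensor_actE.
  etransitivity; first exact: (raddfD (linear_of lf)).
  by rewrite /= !tens_liftE.
Qed.

Definition tensor_hom_lift : lie_hom (tensor_module M N) P :=
  @lie_hom_of K L (tensor_module M N) P (tens_lift f) (tens_lift_linear bf)
    tens_lift_act.

Lemma tensor_hom_liftE m n : tensor_hom_lift (tens m n) = f m n.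
Proof. exact: tens_liftE. Qed.

End Lift.

Section Map.
Variables (M M' N N' : lieModule L) (f : lie_hom M M') (g : lie_hom N N').
Definition tensor_map_pair (m : M) (n : N) : tensor_module M' N' :=
  tens (f m) (g n).
Lemma tensor_map_bilinear : is_bilinear tensor_map_pair.
Proof.
by apply: is_bilinearI => a u v w; rewrite /tensor_map_pair linearP
  ?tensPl ?tensPr.
Qed.
Lemma tensor_map_act (x : L) m n :
  tensor_map_pair (lie_act x m) n + tensor_map_pair m (lie_act x n)
    = lie_act x (tensor_map_pair m n).
Proof. by rewrite [RHS]tensor_actE /tensor_map_pair !lie_hom_act. Qed.
Definition tensor_map : lie_hom (tensor_module M N) (tensor_module M' N') :=
  tensor_hom_lift tensor_map_bilinear tensor_map_act.
Lemma tensor_mapE m n : tensor_map (tens m n) = tens (f m) (g n).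
Proof. exact: tensor_hom_liftE. Qed.
End Map.

Section Associator.
Variables M N P : lieModule L.
Notation MN := (tensor_module M N).
Notation NP := (tensor_module N P).

Definition assoc_pair (p : P) (m : M) (n : N) : tensor_module M NP :=
  tens m (tens n p : NP).
Lemma assoc_pair_bilinear p : is_bilinear (assoc_pair p).
Proof.
apply: is_bilinearI => a u v w; rewrite /assoc_pair ?tensPl //.
exact: (@tensPr K L M NP).
Qed.
Definition assoc_fun (u : MN) (p : P) : tensor_module M NP :=
  tens_lift (assoc_pair p) u.
Lemma assoc_funE m n p : assoc_fun (tens m n) p = tens m (tens n p : NP).
Proof. by rewrite /assoc_fun tens_liftE //; exact: assoc_pair_bilinear. Qed.
Lemma assoc_fun_linear_l p : linear (assoc_fun^~ p).
Proof. exact/tens_lift_linear/assoc_pair_bilinear. Qed.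
Lemma assoc_fun_bilinear : is_bilinear assoc_fun.
Proof.
apply: is_bilinearI => [a u v p|a u p q]; first exact: assoc_fun_linear_l.
pose g v := a *: assoc_fun v p + assoc_fun v q.
rewrite -[RHS]/(g u).
apply: (@tensor_linear_ext K M N (tensor_module M NP)
  (assoc_fun^~ (a *: p + q)) g _ _ _ u).
- exact: assoc_fun_linear_l.
- move=> b v w; rewrite /g !assoc_fun_linear_l !scalerDr !scalerA [a * b]mulrC.
  by rewrite addrACA.
- move=> m n; rewrite /g !assoc_funE tensPr.
  exact: (@tensPr K L M NP).
Qed.
Lemma assoc_fun_act (x : L) u p :
  assoc_fun (lie_act x u) p + assoc_fun u (lie_act x p)
    = lie_act x (assoc_fun u p).
Proof.
pose f v := assoc_fun (lie_act x v) p + assoc_fun v (lie_act x p).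
pose g v := lie_act x (assoc_fun v p).
rewrite -[LHS]/(f u) -[RHS]/(g u).
apply: (@tensor_linear_ext K M N (tensor_module M NP) f g _ _ _ u).
- move=> a v w; rewrite /f (@lie_actP K L MN) !assoc_fun_linear_l scalerDr.
  by rewrite addrACA.
- by move=> a v w; rewrite /g assoc_fun_linear_l lie_actP.
- move=> m n; rewrite /f /g !assoc_funE (@lie_act_tens K L M N).
  rewrite [RHS](@lie_act_tens K L M NP).
  rewrite (@lie_act_tens K L N P).
  have -> : assoc_fun (tens (lie_act x m) n + tens m (lie_act x n)) p
      = assoc_fun (tens (lie_act x m) n) p + assoc_fun (tens m (lie_act x n)) p.
    exact: (raddfD (linear_of (assoc_fun_linear_l p))).
  rewrite !assoc_funE -addrA; congr (_ + _).
  have lr := (tens_bilinear M NP).2 m.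
  by symmetry; exact: (raddfD (linear_of lr)).
Qed.
Definition tensor_assoc : lie_hom (tensor_module MN P) (tensor_module M NP) :=
  tensor_hom_lift assoc_fun_bilinear assoc_fun_act.
Lemma tensor_assocE m n p :
  tensor_assoc (tens (tens m n : MN) p) = tens m (tens n p : NP).
Proof. by rewrite tensor_hom_liftE assoc_funE. Qed.

Definition unassoc_pair (m : M) (n : N) (p : P) : tensor_module MN P :=
  tens (tens m n : MN) p.
Lemma unassoc_pair_bilinear m : is_bilinear (unassoc_pair m).
Proof.
apply: is_bilinearI => a u v w; rewrite /unassoc_pair ?tensPr //.
exact: (@tensPl K L MN).
Qed.
Definition unassoc_fun (m : M) (u : NP) : tensor_module MN P :=
  tens_lift (unassoc_pair m) u.
Lemma unassoc_funE m n p : unassoc_fun m (tens n p) = tens (tens m n : MN) p.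
Proof. by rewrite /unassoc_fun tens_liftE //; exact: unassoc_pair_bilinear. Qed.
Lemma unassoc_fun_linear_r m : linear (unassoc_fun m).
Proof. exact/tens_lift_linear/unassoc_pair_bilinear. Qed.
Lemma unassoc_fun_bilinear : is_bilinear unassoc_fun.
Proof.
apply: is_bilinearI => [a m m' u|a m u v]; last exact: unassoc_fun_linear_r.
pose g v := a *: unassoc_fun m v + unassoc_fun m' v.
rewrite -[RHS]/(g u).
apply: (@tensor_linear_ext K N P (tensor_module MN P)
  (unassoc_fun (a *: m + m')) g _ _ _ u).
- exact: unassoc_fun_linear_r.
- move=> b v w; rewrite /g !unassoc_fun_linear_r !scalerDr !scalerA [a * b]mulrC.
  by rewrite addrACA.
- move=> n p; rewrite /g !unassoc_funE tensPl.
  exact: (@tensPl K L MN).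
Qed.
Lemma unassoc_fun_act (x : L) m u :
  unassoc_fun (lie_act x m) u + unassoc_fun m (lie_act x u)
    = lie_act x (unassoc_fun m u).
Proof.
pose f v := unassoc_fun (lie_act x m) v + unassoc_fun m (lie_act x v).
pose g v := lie_act x (unassoc_fun m v).
rewrite -[LHS]/(f u) -[RHS]/(g u).
apply: (@tensor_linear_ext K N P (tensor_module MN P) f g _ _ _ u).
- move=> a v w; rewrite /f (@lie_actP K L NP) !unassoc_fun_linear_r scalerDr.
  by rewrite addrACA.
- by move=> a v w; rewrite /g unassoc_fun_linear_r lie_actP.
- move=> n p; rewrite /f /g !unassoc_funE (@lie_act_tens K L N P).
  rewrite [RHS](@lie_act_tens K L MN P).
  rewrite (@lie_act_tens K L M N).
  have -> : unassoc_fun m (tens (lie_act x n) p + tens n (lie_act x p))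
      = unassoc_fun m (tens (lie_act x n) p) + unassoc_fun m (tens n (lie_act x p)).
    exact: (raddfD (linear_of (unassoc_fun_linear_r m))).
  rewrite !unassoc_funE addrA; congr (_ + _).
  have ll := (tens_bilinear MN P).1 p.
  by symmetry; exact: (raddfD (linear_of ll)).
Qed.
Definition tensor_unassoc : lie_hom (tensor_module M NP) (tensor_module MN P) :=
  tensor_hom_lift unassoc_fun_bilinear unassoc_fun_act.
Lemma tensor_unassocE m n p :
  tensor_unassoc (tens m (tens n p : NP)) = tens (tens m n : MN) p.
Proof. by rewrite tensor_hom_liftE unassoc_funE. Qed.

End Associator.

Section Unitors.
Variable M : lieModule L.

Definition lunit_fun (c : triv_module L) (m : M) : M := (c : K) *: m.
Lemma lunit_fun_bilinear : is_bilinear lunit_fun.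
Proof.
apply: is_bilinearI => a u v w; rewrite /lunit_fun.
  by rewrite scalerDl scalerA.
by rewrite scalerDr !scalerA mulrC.
Qed.
Lemma lunit_fun_act (x : L) c m :
  lunit_fun (lie_act x c) m + lunit_fun c (lie_act x m) = lie_act x (lunit_fun c m).
Proof. by rewrite /lunit_fun lie_actZ [_ *: m]scale0r add0r. Qed.
Definition tensor_lunit : lie_hom (tensor_module (triv_module L) M) M :=
  tensor_hom_lift lunit_fun_bilinear lunit_fun_act.
Lemma tensor_lunitE (c : triv_module L) m : tensor_lunit (tens c m) = (c : K) *: m.
Proof. exact: tensor_hom_liftE. Qed.

Definition triv_one : triv_module L := (1 : K).

Lemma lie_act_triv (x : L) (c : triv_module L) : lie_act x c = 0.
Proof. by []. Qed.

Definition lununit_fun (m : M) : tensor_module (triv_module L) M := tens triv_one m.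
Lemma lununit_linear : linear lununit_fun.
Proof. by move=> a u v; rewrite /lununit_fun tensPr. Qed.
Lemma lununit_act (x : L) m : lununit_fun (lie_act x m) = lie_act x (lununit_fun m).
Proof.
rewrite [RHS](@lie_act_tens K L (triv_module L) M) lie_act_triv.
rewrite -(subrr (0 : triv_module L)) (@tensBl K L (triv_module L) M) subrr.
by rewrite add0r.
Qed.
Definition tensor_lununit : lie_hom M (tensor_module (triv_module L) M) :=
  @lie_hom_of K L M (tensor_module (triv_module L) M) _ lununit_linear lununit_act.

Definition runit_fun (m : M) (c : triv_module L) : M := (c : K) *: m.
Lemma runit_fun_bilinear : is_bilinear runit_fun.
Proof.
apply: is_bilinearI => a u v w; rewrite /runit_fun.
  by rewrite scalerDr !scalerA mulrC.
by rewrite scalerDl scalerA.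
Qed.
Lemma runit_fun_act (x : L) m c :
  runit_fun (lie_act x m) c + runit_fun m (lie_act x c) = lie_act x (runit_fun m c).
Proof. by rewrite /runit_fun lie_actZ [X in _ + X]scale0r addr0. Qed.
Definition tensor_runit : lie_hom (tensor_module M (triv_module L)) M :=
  tensor_hom_lift runit_fun_bilinear runit_fun_act.
Lemma tensor_runitE m (c : triv_module L) : tensor_runit (tens m c) = (c : K) *: m.
Proof. exact: tensor_hom_liftE. Qed.

Definition rununit_fun (m : M) : tensor_module M (triv_module L) := tens m triv_one.
Lemma rununit_linear : linear rununit_fun.
Proof. by move=> a u v; rewrite /rununit_fun tensPl. Qed.
Lemma rununit_act (x : L) m : rununit_fun (lie_act x m) = lie_act x (rununit_fun m).
Proof.
rewrite [RHS](@lie_act_tens K L M (triv_module L)) lie_act_triv.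
rewrite -(subrr (0 : triv_module L)) (@tensBr K L M (triv_module L)) subrr.
by rewrite addr0.
Qed.
Definition tensor_rununit : lie_hom M (tensor_module M (triv_module L)) :=
  @lie_hom_of K L M (tensor_module M (triv_module L)) _ rununit_linear rununit_act.

Lemma tensZ1l (c : triv_module L) (m : M) :
  tens triv_one ((c : K) *: m) = tens c m.
Proof.
have l1 := (tens_bilinear (triv_module L) M).1 m.
have l2 := (tens_bilinear (triv_module L) M).2 triv_one.
rewrite [LHS](scalable_linear l2) -[LHS](scalable_linear l1).
by congr tens; exact: mulr1.
Qed.
Lemma tensZ1r (c : triv_module L) (m : M) :
  tens ((c : K) *: m) triv_one = tens m c.
Proof.
have l1 := (tens_bilinear M (triv_module L)).1 triv_one.
have l2 := (tens_bilinear M (triv_module L)).2 m.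
rewrite [LHS](scalable_linear l1) -[LHS](scalable_linear l2).
by congr tens; exact: mulr1.
Qed.

End Unitors.

Lemma lie_compE M N P (g : lie_hom N P) (f : lie_hom M N) m :
  lie_comp g f m = g (f m).
Proof. by []. Qed.

Lemma tensor_map1 M N : tensor_map (lie_id M) (lie_id N) = lie_id (tensor_module M N).
Proof. by apply: tensor_hom_ext => m n; rewrite tensor_mapE. Qed.

Lemma tensor_mapM M M' M'' N N' N'' (f : lie_hom M M') (f' : lie_hom M' M'')
    (g : lie_hom N N') (g' : lie_hom N' N'') :
  tensor_map (lie_comp f' f) (lie_comp g' g)
    = lie_comp (tensor_map f' g') (tensor_map f g).
Proof. by apply: tensor_hom_ext => m n; rewrite !(lie_compE, tensor_mapE). Qed.

Definition lie_category : category := {|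
  cat_obj := lieModule L;
  hom := @lie_hom K L;
  idm := @lie_id K L;
  compm := @lie_comp K L;
  compm1l := fun M N f => lie_hom_ext (f := lie_comp (lie_id N) f) (g := f) (fun _ => erefl);
  compm1r := fun M N f => lie_hom_ext (f := lie_comp f (lie_id M)) (g := f) (fun _ => erefl);
  compmA := fun M N P Q h g f =>
    lie_hom_ext (f := lie_comp h (lie_comp g f)) (g := lie_comp (lie_comp h g) f)
      (fun _ => erefl) |}.

Lemma tensor_assoc_iso M N P : @is_iso lie_category _ _ (tensor_assoc M N P).
Proof.
exists (tensor_unassoc M N P); split.
  apply: tensor_hom3_ext => m n p.
  by rewrite lie_compE tensor_assocE tensor_unassocE.
apply: tensor_hom3r_ext => m n p.
by rewrite lie_compE tensor_unassocE tensor_assocE.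
Qed.

Lemma tensor_assoc_nat M M' N N' P P' (f : lie_hom M M') (g : lie_hom N N')
    (h : lie_hom P P') :
  lie_comp (tensor_assoc M' N' P') (tensor_map (tensor_map f g) h)
    = lie_comp (tensor_map f (tensor_map g h)) (tensor_assoc M N P).
Proof.
apply: tensor_hom3_ext => m n p.
by rewrite !(lie_compE, tensor_mapE, tensor_assocE).
Qed.

Lemma tensor_lunit_iso M : @is_iso lie_category _ _ (tensor_lunit M).
Proof.
exists (tensor_lununit M); split.
  apply: tensor_hom_ext => c m; rewrite lie_compE tensor_lunitE.
  exact: tensZ1l.
apply: lie_hom_ext => m; rewrite lie_compE [LHS]tensor_lunitE.
exact: scale1r.
Qed.

Lemma tensor_lunit_nat M N (f : lie_hom M N) :
  lie_comp (tensor_lunit N) (tensor_map (lie_id (triv_module L)) f)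
    = lie_comp f (tensor_lunit M).
Proof.
apply: tensor_hom_ext => c m.
by rewrite !(lie_compE, tensor_mapE, tensor_lunitE) linearZ.
Qed.

Lemma tensor_runit_iso M : @is_iso lie_category _ _ (tensor_runit M).
Proof.
exists (tensor_rununit M); split.
  apply: tensor_hom_ext => m c; rewrite lie_compE tensor_runitE.
  exact: tensZ1r.
apply: lie_hom_ext => m; rewrite lie_compE [LHS]tensor_runitE.
exact: scale1r.
Qed.

Lemma tensor_runit_nat M N (f : lie_hom M N) :
  lie_comp (tensor_runit N) (tensor_map f (lie_id (triv_module L)))
    = lie_comp f (tensor_runit M).
Proof.
apply: tensor_hom_ext => m c.
by rewrite !(lie_compE, tensor_mapE, tensor_runitE) linearZ.
Qed.

Lemma tensor_pentagon M N P Q :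
  lie_comp
    (lie_comp (tensor_map (lie_id M) (tensor_assoc N P Q))
      (tensor_assoc M (tensor_module N P) Q))
    (tensor_map (tensor_assoc M N P) (lie_id Q))
  = lie_comp (tensor_assoc M N (tensor_module P Q))
      (tensor_assoc (tensor_module M N) P Q).
Proof.
apply: tensor_hom4_ext => m n p q.
by rewrite !(lie_compE, tensor_mapE, tensor_assocE).
Qed.

Lemma tensor_triangle M N :
  lie_comp (tensor_map (lie_id M) (tensor_lunit N))
    (tensor_assoc M (triv_module L) N)
  = tensor_map (tensor_runit M) (lie_id N).
Proof.
apply: tensor_hom3_ext => m c n.
rewrite !(lie_compE, tensor_mapE, tensor_assocE, tensor_lunitE, tensor_runitE).
have l1 := (tens_bilinear M N).1 n.
have l2 := (tens_bilinear M N).2 m.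
by rewrite [LHS](scalable_linear l2) -[LHS](scalable_linear l1).
Qed.

Definition lie_monoidal_category : monoidal_category :=
  @MonoidalCategory lie_category (triv_module L) (@tensor_module K L)
    tensor_map tensor_map1 tensor_mapM
    tensor_assoc tensor_assoc_iso tensor_assoc_nat
    tensor_lunit tensor_lunit_iso tensor_lunit_nat
    tensor_runit tensor_runit_iso tensor_runit_nat
    tensor_pentagon tensor_triangle.

End TensorMaps.

Section TensorCategory.
Context (K : fieldType) (L : lieAlgType K) (N : lieModule L).

Definition tensor_category_closed : Prop :=
  @monoidally_closed (lie_monoidal_category L) (tensor_category_obj N).

(** Closure under tensor products is an argument: for an arbitrary pair [L],
    [N] the tensor product of two modules of finite length may have infinite
    length. *)
Definition tensor_category (h : tensor_category_closed) : monoidal_category :=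
  full_monoidal_subcategory h.

End TensorCategory.

(* Main.v *)
Require Import Defs.
From HB Require Import structures.
From mathcomp Require Import all_boot all_order all_algebra.
From mathcomp Require Import all_classical.
From mathcomp Require Import reals complex.

(** The equivalence is the restriction functor. Write [L] for the Mackey Lie algebra,
    [N] for its module [V + W] or [V], and [A] for the dense subalgebra.

    Density passes from [N] to every module built from tensor powers of [N] by finite
    sums, submodules and quotients: the action of an element of [L] on a vector of
    such a module depends only on its action on finitely many vectors of [N]
    ([tensorial_controlled], [tensorial_dense]). Hence, on these modules, an
    [A]-linear map is [L]-linear and an [A]-submodule is an [L]-submodule, so that
    restriction is fully faithful ([res_hom_full]) and essentially surjective
    ([tensorial_res_ess]). It is monoidal with identities as structure maps.

    It remains to identify these modules with the objects of the two categories, and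
    to see that the categories are closed under tensor products at all
    ([tensor_category_objP], [tensorial_tensor]). Both come down to the fact that
    the tensor powers of [N] have finite length, over [L] and over [A]
    ([ranked_tensor_power]). This is proved without a classification of simple
    modules. Let [u] be a tensor of degree [p] whose factors lie in the span of a
    finite set [s]. Choose a dual system [(e_i, f_i)] for [s] and a pair [e], [f]
    orthogonal to it, and put [D_i = e ^ f_i], [U_i = e_i ^ f] in [L], where, say in the
    orthogonal case, [v ^ w] maps [x] to [(w, x) v - (v, x) w]. Then
    [C = sum_i U_i D_i] fixes the vectors of [s], and on tensors
    [C u = p u - b], where [b] collects contractions of [u], each with [e], [f] in
    place of the two contracted factors ([casimir_mixed]). If [u] lies in a
    submodule [M'], then so do the [D_i u], and therefore [C u] and [b]; all the
    [D_i u] and [b] have fewer factors in [s] than [u], and [u] is recovered from them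
    by [L] in characteristic zero. After [p] rounds, each with a new pair, [M'] is
    seen to contain enough tensors in the [2 p] chosen vectors to generate [u]
    ([mixed_generated]). These tensors span a space whose dimension depends on [p]
    only, which bounds the length of every chain of submodules.

    The argument uses [L] only through the existence of the operators [U_i], [D_i]
    ([movable]), a property that passes to dense subalgebras ([movable_restrict])
    and holds for the three families by explicit operators of rank at most two
    ([movable_gl], [movable_iso]). *)

Set Implicit Arguments.
Unset Strict Implicit.
Unset Printing Implicit Defensive.

Import GRing.Theory.
Local Open Scope ring_scope.
Local Open Scope complex_scope.

(** * Submodules, homomorphisms and subquotients *)

Section Homs.
Context (K : fieldType) (L : lieAlgType K).
Implicit Types M X Q : lieModule L.

Section SubmoduleOf.
Variables (M : lieModule L) (P : M -> Prop) (P0 : P 0).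
Hypothesis PP : forall c u v, P u -> P v -> P (c *: u + v).
Hypothesis Pact : forall (x : L) u, P u -> P (lie_act x u).

Definition prop_pred : {pred M} := fun u => `[< P u >].

Lemma prop_pred_closed : GRing.submod_closed prop_pred.
Proof.
split; first exact/asboolP.
by move=> c u v /asboolP Pu /asboolP Pv; apply/asboolP; exact: PP.
Qed.

Definition prop_submod : submodClosed M :=
  HB.pack prop_pred (GRing.isSubmodClosed.Build K M prop_pred prop_pred_closed).

Lemma prop_submod_act (x : L) u : u \in prop_submod -> lie_act x u \in prop_submod.
Proof. by move=> /asboolP Pu; apply/asboolP; exact: Pact. Qed.

Definition submodule_of : submodule M := Submodule prop_submod_act.

Lemma submodule_ofP u : (u \in submodule_of) <-> P u.
Proof. by split=> [/asboolP|] // Pu; apply/asboolP. Qed.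

End SubmoduleOf.

Lemma lie_hom_inverse M X (f : lie_hom M X) :
  injective f -> (forall x, exists m, f m = x) ->
  exists g : lie_hom X M, cancel f g /\ cancel g f.
Proof.
move=> f_inj f_surj; pose g x := sval (cid (f_surj x)).
have gK : cancel g f by move=> x; exact: (svalP (cid (f_surj x))).
have lg : linear g by move=> c u v; apply: f_inj; rewrite linearP !gK.
have eg (x : L) u : g (lie_act x u) = lie_act x (g u).
  by apply: f_inj; rewrite lie_hom_act !gK.
by exists (lie_hom_of lg eg); split=> // m; apply: f_inj; exact: gK.
Qed.

Lemma submodule_closed M (S : submodule M) c u v :
  u \in S -> v \in S -> c *: u + v \in S.
Proof. by move=> Su Sv; rewrite rpredD // rpredZ. Qed.
Lemma submoduleB M (S : submodule M) u v : u \in S -> v \in S -> u - v \in S.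
Proof. by move=> Su Sv; rewrite addrC -scaleN1r; exact: submodule_closed. Qed.

Section Incl.
Variables (M : lieModule L) (S : submodule M).
Lemma sub_incl_linear : linear (fun u : sub_module S => sval u : M).
Proof. by []. Qed.
Definition sub_incl : lie_hom (sub_module S) M :=
  @lie_hom_of K L (sub_module S) M _ sub_incl_linear (fun _ _ => erefl).
Lemma sub_incl_inj : injective sub_incl.
Proof. exact: val_inj. Qed.
Definition quot_proj : lie_hom M (quot_module S) :=
  @lie_hom_of K L M (quot_module S) (to_quot S) (@to_quot_linear K M S)
    (fun x m => esym (quot_actE S x m)).
Lemma quot_proj_surj (u : quot_module S) : exists m, quot_proj m = u.
Proof. by elim/to_quotW: u => m; exists m. Qed.
Lemma quot_projP u v : quot_proj u = quot_proj v <-> u - v \in S.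
Proof. exact: to_quotP. Qed.
End Incl.

Section Dsum2.
Variables M N : lieModule L.
Lemma dsum2_fst_linear : linear (fun u : dsum2 M N => u.1 : M). Proof. by []. Qed.
Lemma dsum2_snd_linear : linear (fun u : dsum2 M N => u.2 : N). Proof. by []. Qed.
Definition dsum2_fst : lie_hom (dsum2 M N) M :=
  @lie_hom_of K L (dsum2 M N) M _ dsum2_fst_linear (fun _ _ => erefl).
Definition dsum2_snd : lie_hom (dsum2 M N) N :=
  @lie_hom_of K L (dsum2 M N) N _ dsum2_snd_linear (fun _ _ => erefl).
Lemma dsum2_inl_linear : linear (fun u : M => (u, 0) : dsum2 M N).
Proof.
by move=> c u v; congr (_, _); rewrite /= scaler0 addr0.
Qed.
Lemma dsum2_inl_act (x : L) (u : M) :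
  (lie_act x u, 0) = lie_act x ((u, 0) : dsum2 M N) :> dsum2 M N.
Proof. by congr (_, _); rewrite lie_act0. Qed.
Definition dsum2_inl : lie_hom M (dsum2 M N) :=
  @lie_hom_of K L M (dsum2 M N) _ dsum2_inl_linear dsum2_inl_act.
Lemma dsum2_inr_linear : linear (fun u : N => (0, u) : dsum2 M N).
Proof. by move=> c u v; congr (_, _); rewrite /= scaler0 addr0. Qed.
Lemma dsum2_inr_act (x : L) (u : N) :
  (0, lie_act x u) = lie_act x ((0, u) : dsum2 M N) :> dsum2 M N.
Proof. by congr (_, _); rewrite lie_act0. Qed.
Definition dsum2_inr : lie_hom N (dsum2 M N) :=
  @lie_hom_of K L N (dsum2 M N) _ dsum2_inr_linear dsum2_inr_act.
End Dsum2.

Section Pair.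
Variables (Y M N : lieModule L) (f : lie_hom Y M) (g : lie_hom Y N).
Lemma hom_pair_linear : linear (fun u : Y => (f u, g u) : dsum2 M N).
Proof. by move=> c u v; rewrite !linearP. Qed.
Lemma hom_pair_act (x : L) (u : Y) :
  (f (lie_act x u), g (lie_act x u)) = lie_act x ((f u, g u) : dsum2 M N) :> dsum2 M N.
Proof. by rewrite !lie_hom_act. Qed.
Definition hom_pair : lie_hom Y (dsum2 M N) :=
  @lie_hom_of K L Y (dsum2 M N) _ hom_pair_linear hom_pair_act.
End Pair.

Section Zero.
Variables (M N : lieModule L).
Lemma hom_zero_linear : linear (fun _ : M => 0 : N).
Proof. by move=> c u v; rewrite scaler0 addr0. Qed.
Definition hom_zero : lie_hom M N :=
  @lie_hom_of K L M N _ hom_zero_linear (fun x _ => esym (lie_act0 _ x)).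
End Zero.

Section ImagePreimage.
Variables (M X : lieModule L) (f : lie_hom M X).

Lemma hom0 : f 0 = 0. Proof. exact: raddf0. Qed.

Definition hom_preimage (S : submodule X) : submodule M.
Proof.
refine (@submodule_of M (fun u => f u \in S) _ _ _).
- by rewrite hom0 rpred0.
- by move=> c u v Su Sv; rewrite linearP rpredD // rpredZ.
- by move=> x u Su; rewrite lie_hom_act submodule_act.
Defined.

Lemma hom_preimageP (S : submodule X) u : (u \in hom_preimage S) <-> f u \in S.
Proof. exact: submodule_ofP. Qed.

Definition hom_image (S : submodule M) : submodule X.
Proof.
refine (@submodule_of X (fun v => exists2 u, u \in S & f u = v) _ _ _).
- by exists 0; rewrite ?rpred0 ?hom0.
- move=> c _ _ [u Su <-] [v Sv <-].
  by exists (c *: u + v); rewrite ?linearP // rpredD // rpredZ.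
- by move=> x _ [u Su <-]; exists (lie_act x u); rewrite ?lie_hom_act ?submodule_act.
Defined.

Lemma hom_imageP (S : submodule M) v : (v \in hom_image S) <-> exists2 u, u \in S & f u = v.
Proof. exact: submodule_ofP. Qed.

End ImagePreimage.

Definition submodule_full M : submodule M.
Proof. by refine (@submodule_of M (fun=> True) _ _ _). Defined.
Lemma submodule_fullP M (u : M) : u \in submodule_full M.
Proof. exact/submodule_ofP. Qed.

Definition submodule_zero M : submodule M.
Proof.
refine (@submodule_of M (fun u => u = 0) _ _ _) => //.
- by move=> c u v -> ->; rewrite scaler0 addr0.
- by move=> x u ->; rewrite lie_act0.
Defined.
Lemma submodule_zeroP M (u : M) : (u \in submodule_zero M) <-> u = 0.
Proof. exact: submodule_ofP. Qed.

(** A subquotient as a span [X <- Q -> M]. Unlike a submodule of a submodule, a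
    span is moved along homomorphisms by composing its legs. *)
Definition subquotient M X : Prop :=
  exists Q (i : lie_hom Q X) (q : lie_hom Q M),
    injective i /\ forall m, exists u, q u = m.

(** From a span, [S] is the image of [Q] in [X], and [S'] is the image of the
    kernel of [Q -> M]; the isomorphism is the first isomorphism theorem. *)
Lemma is_subquotientP M X : is_subquotient M X <-> subquotient M X.
Proof.
split=> [[S [S' [f [g [fK gK]]]]]|[Q [i [q [i_inj q_surj]]]]].
  exists (sub_module S), (sub_incl S), (lie_comp g (quot_proj S')).
  split=> [|m]; first exact: sub_incl_inj.
  by have [u e] := quot_proj_surj (f m); exists u; rewrite lie_compE e fK.
pose S := hom_image i (submodule_full Q).
pose S' := hom_preimage (sub_incl S) (hom_image i (hom_preimage q (submodule_zero M))).
exists S, S'.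
have iS u : i u \in S by apply/hom_imageP; exists u; rewrite ?submodule_fullP.
pose mk u : sub_module S := exist _ (i u) (iS u).
have mk_linear : linear mk by move=> c u v; apply/val_inj; rewrite /= linearP.
have mk_act (x : L) u : mk (lie_act x u) = lie_act x (mk u).
  by apply/val_inj; rewrite /= lie_hom_act.
have S'P u : mk u \in S' <-> q u = 0.
  split=> [/hom_preimageP /hom_imageP[v /hom_preimageP/submodule_zeroP qv /i_inj <- //]|qu].
  by apply/hom_preimageP/hom_imageP; exists u => //; apply/hom_preimageP/submodule_zeroP.
have mkP u v : quot_proj S' (mk u) = quot_proj S' (mk v) <-> q u = q v.
  rewrite quot_projP -(raddfB (linear_of mk_linear)) S'P linearB /=.
  by split=> [/eqP|->]; rewrite ?subrr // subr_eq0 => /eqP.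
pose pre m := sval (cid (q_surj m)).
have preK : cancel pre q by move=> m; exact: (svalP (cid (q_surj m))).
pose phi m : quot_module S' := quot_proj S' (mk (pre m)).
have lphi : linear phi.
  move=> c u v; rewrite -(linearP (quot_proj S')) -mk_linear.
  by apply/mkP; rewrite linearP !preK.
have ephi (x : L) m : phi (lie_act x m) = lie_act x (phi m).
  by rewrite -(lie_hom_act (quot_proj S')) -mk_act; apply/mkP; rewrite lie_hom_act !preK.
have phi_inj : injective phi by move=> u v /(mkP _ _).1; rewrite !preK.
have phi_surj w : exists m, phi m = w.
  have [[v Sv] <-] := quot_proj_surj w.
  have /hom_imageP[u _ e] := Sv.
  exists (q u); have -> : exist _ v Sv = mk u by apply/val_inj.
  by apply/(mkP _ _).2; rewrite preK.
by exists (lie_hom_of lphi ephi); exact: lie_hom_inverse.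
Qed.

End Homs.

(** * Rank functions and finite length *)

Section Rank.
Context (K : fieldType) (L : lieAlgType K).
Implicit Types M X Q : lieModule L.

Definition subm_le M (A B : submodule M) : Prop := forall u, u \in A -> u \in B.

(** A bound on the length of [M], as a number attached to each submodule that
    grows strictly along strict inclusions. In contrast with composition series,
    such a function is transported to submodules and quotients by taking images
    and preimages, without any Jordan-Hoelder argument. *)
Definition rank_function M (d : submodule M -> nat) : Prop :=
  forall A B, subm_le A B -> (d A <= d B)%N /\ ((d B <= d A)%N -> subm_le B A).

Definition ranked M : Prop := exists d, @rank_function M d.

Lemma ranked_inj M X (f : lie_hom M X) : injective f -> ranked X -> ranked M.
Proof.
move=> f_inj [d dP]; exists (fun A => d (hom_image f A)) => A B AB.
have /dP[le eq] : subm_le (hom_image f A) (hom_image f B).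
  by move=> _ /hom_imageP[u /AB Bu <-]; apply/hom_imageP; exists u.
split=> // /eq BA u Bu.
have /BA /hom_imageP[v Av /f_inj <- //] : f u \in hom_image f B.
by apply/hom_imageP; exists u.
Qed.

Lemma ranked_surj X M (q : lie_hom X M) :
  (forall m, exists u, q u = m) -> ranked X -> ranked M.
Proof.
move=> q_surj [d dP]; exists (fun A => d (hom_preimage q A)) => A B AB.
have /dP[le eq] : subm_le (hom_preimage q A) (hom_preimage q B).
  by move=> u /hom_preimageP Au; apply/hom_preimageP/AB.
split=> // /eq BA m; have [u <-] := q_surj m => Bu.
by apply/hom_preimageP/BA/hom_preimageP.
Qed.

(** A submodule of [M + X] is measured by its intersection with [M] and its
    projection to [X]; by the modular law, two nested submodules that agree in
    both are equal. *)
Lemma ranked_dsum2 M X : ranked M -> ranked X -> ranked (dsum2 M X).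
Proof.
move=> [d dP] [d' dP'].
exists (fun A => d (hom_preimage (dsum2_inl M X) A) + d' (hom_image (dsum2_snd M X) A))%N.
move=> A B AB.
have /dP[le eq] : subm_le (hom_preimage (dsum2_inl M X) A) (hom_preimage (dsum2_inl M X) B).
  by move=> u /hom_preimageP Au; apply/hom_preimageP/AB.
have /dP'[le' eq'] : subm_le (hom_image (dsum2_snd M X) A) (hom_image (dsum2_snd M X) B).
  by move=> _ /hom_imageP[u /AB Bu <-]; apply/hom_imageP; exists u.
split=> [|ge]; first exact: leq_add.
have /eq BA : (d (hom_preimage (dsum2_inl M X) B) <= d (hom_preimage (dsum2_inl M X) A))%N.
  by rewrite -(leq_add2r (d' (hom_image (dsum2_snd M X) B))) (leq_trans ge) // leq_add2l.
have /eq' BA' : (d' (hom_image (dsum2_snd M X) B) <= d' (hom_image (dsum2_snd M X) A))%N.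
  by rewrite -(leq_add2l (d (hom_preimage (dsum2_inl M X) B))) (leq_trans ge) // leq_add2r.
move=> b Bb; have /BA' /hom_imageP[a Aa e] : dsum2_snd M X b \in hom_image (dsum2_snd M X) B.
  by apply/hom_imageP; exists b.
have ba : b - a = dsum2_inl M X (b.1 - a.1).
  by congr (_, _); rewrite -/(b.2 - a.2); apply/eqP; rewrite subr_eq0; apply/eqP.
rewrite -[b](subrK a) rpredD // ba; apply/hom_preimageP/BA/hom_preimageP.
by rewrite -ba; apply: (submoduleB Bb); exact: AB.
Qed.

(** A proper submodule [B] of maximal rank is a maximal submodule, so [M / B] is
    simple, and [B] has smaller rank than [M]. *)
Lemma ranked_finite_length M : ranked M -> finite_length M.
Proof.
move=> [d dP]; have [n] := ubnP (d (submodule_full M)).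
elim: n M d dP => // n IH M d dP dn.
have [M0|] := pselect (is_zero_module M); first exact: FiniteLengthZero.
move=> /existsNP[m0 m0P].
pose proper (B : submodule M) := exists m, m \notin B.
have P0 : exists k, `[< exists B, proper B /\ d B = k >].
  exists (d (submodule_zero M)); apply/asboolP; exists (submodule_zero M); split=> //.
  by exists m0; apply/negP => /submodule_zeroP.
have full_le A : subm_le A (submodule_full M) by move=> u _; exact: submodule_fullP.
have Pbound k : `[< exists B, proper B /\ d B = k >] -> (k <= d (submodule_full M))%N.
  by move=> /asboolP[B [_ <-]]; exact: (dP _ _ (full_le B)).1.
case: (ex_maxnP P0 Pbound) => k /asboolP[B [[m mB] dB]] kmax.
apply: (@FiniteLengthStep _ _ _ B).
  apply: (IH _ (fun A => d (hom_image (sub_incl B) A))) => [A A' AA'|].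
    have /dP[le eq] : subm_le (hom_image (sub_incl B) A) (hom_image (sub_incl B) A').
      by move=> _ /hom_imageP[u /AA' Bu <-]; apply/hom_imageP; exists u.
    split=> // /eq A'A u A'u.
    have /A'A /hom_imageP[v Av /sub_incl_inj <- //] : sub_incl B u \in hom_image (sub_incl B) A'.
    by apply/hom_imageP; exists u.
  have iB : subm_le (hom_image (sub_incl B) (submodule_full _)) B.
    by move=> _ /hom_imageP[[u Bu] _ <-].
  rewrite (leq_ltn_trans (dP _ _ iB).1) // -ltnS (leq_trans _ dn) // ltnS ltnNge.
  apply/negP => /((dP _ _ (full_le B)).2) h; move/negP: mB; apply; apply: h.
  exact: submodule_fullP.
split=> [z|S].
  have := z (quot_proj B m); rewrite -(raddf0 (quot_proj B)).
  by move=> /(quot_projP _ _ _).1; rewrite subr0 (negPf mB).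
have [Sfull|] := pselect (forall u, u \in hom_preimage (quot_proj B) S).
  by right=> u; have [v <-] := quot_proj_surj u; apply/hom_preimageP.
move=> /existsNP[v /negP Sv]; left=> u; have [w <-] := quot_proj_surj u => Sw.
have BS : subm_le B (hom_preimage (quot_proj B) S).
  move=> b Bb; apply/hom_preimageP.
  have -> : quot_proj B b = 0.
    by rewrite -(raddf0 (quot_proj B)); apply/(quot_projP _ _ _).2; rewrite subr0.
  exact: rpred0.
have /((dP _ _ BS).2) SB : (d (hom_preimage (quot_proj B) S) <= d B)%N.
  by rewrite dB; apply/kmax/asboolP; exists (hom_preimage (quot_proj B) S); split=> //; exists v.
rewrite -(raddf0 (quot_proj B)); apply/(quot_projP _ _ _).2; rewrite subr0.
exact/SB/hom_preimageP.
Qed.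

(** Finite generation is what confines a subquotient of [T(N)^n] of finite length
    to finitely many tensor degrees. *)
Lemma finite_length_gen M : finite_length M ->
  exists s : seq M, forall B : submodule M, (forall x, x \in s -> x \in B) ->
    forall m, m \in B.
Proof.
elim=> {}M => [M0|S _ [s sP] [nz simple]].
  by exists [::] => B _ m; rewrite (M0 m) rpred0.
have [u0 u0P] : exists u : quot_module S, u <> 0 by exact/existsNP.
have [m0 e0] := quot_proj_surj u0.
exists (m0 :: map (sub_incl S) s) => B Bs m.
have SB u : u \in S -> u \in B.
  move=> Su; have sB x : x \in s -> x \in hom_preimage (sub_incl S) B.
    move=> xs; apply/hom_preimageP/Bs.
    by rewrite inE; apply/orP; right; apply: map_f.
  by have /hom_preimageP := sP _ sB (exist _ u Su).
have [Bz|Bfull] := simple (hom_image (quot_proj S) B).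
  case: u0P; rewrite -e0; apply: Bz; apply/hom_imageP; exists m0 => //.
  by apply: Bs; rewrite mem_head.
have /hom_imageP[b Bb e] := Bfull (quot_proj S m).
by rewrite -[m](subrK b) rpredD //; apply/SB/(quot_projP _ _ _).1.
Qed.

End Rank.

(** * Chains of submodules and finite spans *)

Section Chains.
Context (K : fieldType) (L : lieAlgType K) (M : lieModule L).

Definition strict_chain (c : nat -> submodule M) (l : nat) : Prop :=
  forall i, (i < l)%N -> subm_le (c i) (c i.+1) /\ exists2 u, u \in c i.+1 & u \notin c i.

(** The rank of [A] is the greatest length of a strict chain that ends inside
    [A]; a strictly larger submodule prolongs the chain by one step. *)
Lemma bounded_chains_ranked n :
  (forall c l, strict_chain c l -> (l <= n)%N) -> ranked M.
Proof.
move=> bnd; pose reach A l := exists2 c, strict_chain c l & subm_le (c l) A.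
have ex0 A : exists l, `[< reach A l >] by exists 0%N; apply/asboolP; exists (fun=> A).
have exb A l : `[< reach A l >] -> (l <= n)%N by move=> /asboolP[c /bnd].
exists (fun A => ex_maxn (ex0 A) (exb A)) => A B AB.
case: (ex_maxnP (ex0 A) (exb A)) => a /asboolP[c cA ca] _.
case: (ex_maxnP (ex0 B) (exb B)) => b /asboolP _ bmax.
split=> [|ba u Bu]; first by apply/bmax/asboolP; exists c => // u /ca/AB.
apply/negPn/negP => Au; have /bmax : `[< reach B a.+1 >].
  apply/asboolP; exists (fun i => if (i <= a)%N then c i else B).
    move=> i; rewrite ltnS => le_ia; rewrite le_ia.
    move: le_ia; rewrite leq_eqVlt => /predU1P[->|ia].
      rewrite ltnn; split=> [v /ca/AB //|].
      by exists u => //; apply: contra Au => /ca.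
    by rewrite ia; exact: cA.
  by rewrite /= ltnn.
by move=> /leq_trans/(_ ba); rewrite ltnn.
Qed.

End Chains.

Section Span.
Context (K : fieldType) (M : lmodType K).

(** Membership in every linear subspace that contains [s]: this form gives an
    induction principle for the span without any coordinates. *)
Definition in_span (s : seq M) (u : M) : Prop :=
  forall P : M -> Prop, P 0 -> (forall c v w, P v -> P w -> P (c *: v + w)) ->
    (forall v, v \in s -> P v) -> P u.

Lemma in_span_mem s u : u \in s -> in_span s u.
Proof. by move=> su P _ _; exact. Qed.
Lemma in_span0 s : in_span s 0. Proof. by []. Qed.
Lemma in_spanP s c u v : in_span s u -> in_span s v -> in_span s (c *: u + v).
Proof. by move=> su sv P P0 PP Ps; exact: (PP _ _ _ (su P P0 PP Ps) (sv P P0 PP Ps)). Qed.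
Lemma in_spanZ s c u : in_span s u -> in_span s (c *: u).
Proof. by move=> su; rewrite -[c *: u]addr0; apply: in_spanP => //; exact: in_span0. Qed.

Lemma in_span_coord s u :
  in_span s u -> exists c : 'rV[K]_(size s), u = \sum_i c 0 i *: s`_i.
Proof.
move=> su.
apply: (su (fun u => exists c : 'rV[K]_(size s), u = \sum_i c 0 i *: s`_i))
  => [|c _ _ [a ->] [b ->]|v vs].
- by exists 0; rewrite big1 // => i _; rewrite mxE scale0r.
- exists (c *: a + b); rewrite scaler_sumr -big_split; apply: eq_bigr => i _.
  by rewrite !mxE scalerDl scalerA.
- have vl : (index v s < size s)%N by rewrite index_mem.
  exists (delta_mx 0 (Ordinal vl)); rewrite (bigD1 (Ordinal vl)) //= mxE !eqxx.
  rewrite scale1r nth_index // big1 ?addr0 // => i ne.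
  by rewrite mxE (negPf ne) andbF scale0r.
Qed.

(** In a linear relation between the [z i], the one of greatest index would lie
    in a subspace that contains all the others but not it. Hence their coordinate
    vectors are independent. *)
Lemma span_chain_bound s (F : nat -> submodClosed M) (z : nat -> M) l :
  (forall i j, (i <= j)%N -> (j <= l)%N -> forall u, u \in F i -> u \in F j) ->
  (forall i, (i < l)%N -> [/\ in_span s (z i), z i \in F i.+1 & z i \notin F i]) ->
  (l <= size s)%N.
Proof.
move=> Fle zP.
pose co i := if pselect (i < l)%N is left h
  then sval (cid (in_span_coord (let: And3 a _ _ := zP i h in a))) else 0.
have coE i : (i < l)%N -> z i = \sum_j co i 0 j *: s`_j.
  by rewrite /co; case: pselect => // h _; case: (cid _).
(* The relation is a row vector killing the matrix of coordinates. *)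
pose A := \matrix_(i < l, j < size s) co i 0 j.
suff /eqP <- : row_free A by exact: rank_leq_col.
apply/negPn/negP => nf; have [w [wA w0]] : exists w : 'rV_l, w *m A = 0 /\ w != 0.
  have /rowV0Pn[w /sub_kermxP wA w0] : kermx A != 0 by rewrite kermx_eq0.
  by exists w.
have [i0 wi0] : exists i, w 0 i != 0 by apply/rV0Pn.
pose i := [arg max_(i > i0 | w 0 i != 0) (i : nat)].
have [wi imax] : w 0 i != 0 /\ forall j, w 0 j != 0 -> (j <= i)%N.
  by rewrite /i; case: arg_maxnP => // k wk kmax.
have wz : \sum_j w 0 j *: z j = 0.
  transitivity (\sum_k (w *m A) 0 k *: s`_k).
    rewrite (eq_bigr (fun j => \sum_k (w 0 j * A j k) *: s`_k)).
      rewrite exchange_big; apply: eq_bigr => k _.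
      by rewrite mxE scaler_suml.
    move=> j _; rewrite (coE j) // scaler_sumr; apply: eq_bigr => k _.
    by rewrite mxE scalerA.
  by rewrite wA big1 // => k _; rewrite mxE scale0r.
have [_ _ /negP] := zP i (ltn_ord i); apply.
have -> : z i = (- (w 0 i)^-1) *: \sum_(j | j != i) w 0 j *: z j.
  move: wz; rewrite (bigD1 i) //= => /eqP; rewrite addr_eq0 => /eqP e.
  by rewrite scaleNr -scalerN -e scalerA mulVf // scale1r.
rewrite rpredZ // rpred_sum // => j ji; have [->|/imax jle] := eqVneq (w 0 j) 0.
  by rewrite scale0r rpred0.
have jlt : (j < i)%N by rewrite ltn_neqAle jle andbT; exact: ji.
have [_ Fj _] := zP j (ltn_ord j).
by rewrite rpredZ //; apply: Fle Fj => //; exact: ltnW.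
Qed.

End Span.

(** * Casimir operators on tensors *)

Section Casimir.
Context (K : fieldType) (L : lieAlgType K).

(** The shape of a Casimir element, for an arbitrary list of pairs instead of dual
    bases for an invariant form. *)
Definition casimir (M : lieModule L) (ops : seq (L * L)) (u : M) : M :=
  \sum_(o <- ops) lie_act o.1 (lie_act o.2 u).

Lemma casimir_linear (M : lieModule L) ops : linear (@casimir M ops).
Proof.
move=> c u v; rewrite /casimir scaler_sumr -big_split.
by apply: eq_bigr => o _; rewrite !lie_actP.
Qed.

Variable N : lieModule L.

Definition tcons (p : nat) (x : N) (u : tensor_power N p) : tensor_power N p.+1 :=
  tens x u.

Lemma tconsPl p c x y (u : tensor_power N p) :
  tcons (c *: x + y) u = c *: tcons x u + tcons y u.
Proof. exact: tensPl. Qed.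
Lemma tconsPr p x c (u v : tensor_power N p) :
  tcons x (c *: u + v) = c *: tcons x u + tcons x v.
Proof. exact: tensPr. Qed.
Definition tconsl p (u : tensor_power N p) : {linear N -> tensor_power N p.+1} :=
  linear_of (fun c x y => tconsPl c x y u).
Lemma tcons0l p (u : tensor_power N p) : tcons 0 u = 0.
Proof.
exact: (raddf0 (tconsl u)).
Qed.
Lemma tcons0r p x : tcons x (0 : tensor_power N p) = 0.
Proof. exact: (raddf0 (linear_of (@tconsPr p x))). Qed.
Lemma tconsBZ p x c (u v : tensor_power N p) :
  tcons x (u - c *: v) = tcons x u - c *: tcons x v.
Proof. by rewrite -scaleNr addrC tconsPr scaleNr addrC. Qed.
Lemma tcons_sumr p x (I : Type) (r : seq I) (F : I -> tensor_power N p) :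
  tcons x (\sum_(i <- r) F i) = \sum_(i <- r) tcons x (F i).
Proof. exact: (raddf_sum (linear_of (@tconsPr p x))). Qed.
Lemma tcons_suml p (u : tensor_power N p) (I : Type) (r : seq I) (F : I -> N) :
  tcons (\sum_(i <- r) F i) u = \sum_(i <- r) tcons (F i) u.
Proof.
exact: (raddf_sum (tconsl u)).
Qed.

Lemma act_tcons p (a : L) x (u : tensor_power N p) :
  lie_act a (tcons x u) = tcons (lie_act a x) u + tcons x (lie_act a u).
Proof. exact: lie_act_tens. Qed.

Lemma casimir_tcons p ops x (u : tensor_power N p) :
  casimir ops (tcons x u) = tcons (casimir ops x) u
    + \sum_(o <- ops) (tcons (lie_act o.2 x) (lie_act o.1 u)
                     + tcons (lie_act o.1 x) (lie_act o.2 u))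
    + tcons x (casimir ops u).
Proof.
have E (o : L * L) : lie_act o.1 (lie_act o.2 (tcons x u))
    = tcons (lie_act o.1 (lie_act o.2 x)) u
      + (tcons (lie_act o.2 x) (lie_act o.1 u) + tcons (lie_act o.1 x) (lie_act o.2 u))
      + tcons x (lie_act o.1 (lie_act o.2 u)).
  by rewrite act_tcons lie_actD !act_tcons !addrA.
by rewrite /casimir tcons_suml tcons_sumr (eq_bigr _ (fun o _ => E o)) !big_split.
Qed.

Lemma tensor_power_ind p (P : tensor_power N p.+1 -> Prop) :
  P 0 -> (forall u v, P u -> P v -> P (u + v)) -> (forall x u, P (tcons x u)) ->
  forall u, P u.
Proof.
move=> P0 PD Pt u; rewrite [u](@tensor_sum K N (tensor_power N p) u).
by elim/big_ind: _ => // o _; exact: Pt.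
Qed.

(** The number [d] only bounds the number of factors in [s], because the operators
    below lower it by one or by two according to the term. *)
Inductive mixed (s t : seq N) : forall p, nat -> tensor_power N p -> Prop :=
| mixed_unit d (c : tensor_power N 0) : @mixed s t 0 d c
| mixed_left p d x (u : tensor_power N p) :
    x \in s -> mixed s t d u -> mixed s t d.+1 (tcons x u)
| mixed_right p d y (u : tensor_power N p) :
    y \in t -> mixed s t d u -> mixed s t d (tcons y u)
| mixed0 p d : mixed s t d (0 : tensor_power N p)
| mixedP p d c (u v : tensor_power N p) :
    mixed s t d u -> mixed s t d v -> mixed s t d (c *: u + v).

Lemma mixed_sub s t s' t' p d (u : tensor_power N p) :
  {subset s <= s'} -> {subset t <= t'} -> mixed s t d u -> mixed s' t' d u.
Proof.
move=> ss tt; elim=> {p d u} [d c|p d x u /ss ? _ ?|p d y u /tt ? _ ?|p d|p d c u v _ ? _ ?].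
- exact: mixed_unit.
- exact: mixed_left.
- exact: mixed_right.
- exact: mixed0.
- exact: mixedP.
Qed.

Lemma mixedS s t p d (u : tensor_power N p) : mixed s t d u -> mixed s t d.+1 u.
Proof.
elim=> {p d u} [d c|p d x u ? _ ?|p d y u ? _ ?|p d|p d c u v _ ? _ ?].
- exact: mixed_unit.
- exact: mixed_left.
- exact: mixed_right.
- exact: mixed0.
- exact: mixedP.
Qed.

Lemma mixed_exists p (u : tensor_power N p) : exists s, mixed s [::] p u.
Proof.
elim: p u => [|p IH] u; first by exists [::]; exact: mixed_unit.
elim/tensor_power_ind: u => [|u v [s su] [s' sv]|x u].
- by exists [::]; exact: mixed0.
- exists (s ++ s'); rewrite -[u]scale1r; apply: mixedP.
    by apply: mixed_sub su => // x; rewrite mem_cat => ->.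
  by apply: mixed_sub sv => // x; rewrite mem_cat => ->; rewrite orbT.
- have [s su] := IH u; exists (x :: s); apply: mixed_left; first exact: mem_head.
  by apply: mixed_sub su => // y; rewrite inE => ->; rewrite orbT.
Qed.

Lemma mixed_exists_all p l (a : nat -> tensor_power N p) :
  exists s, forall i, (i < l)%N -> mixed s [::] p (a i).
Proof.
elim: l => [|l [s sP]]; first by exists [::].
have [s' s'P] := mixed_exists (a l); exists (s ++ s') => i.
rewrite ltnS leq_eqVlt => /predU1P[->|/sP si].
  by apply: mixed_sub s'P => // x; rewrite mem_cat => ->; rewrite orbT.
by apply: mixed_sub si => // x; rewrite mem_cat => ->.
Qed.

(** Strictly fewer than [d] factors in [s]; without this reading of [d = 0] a
    decrease of [d] could not be stated uniformly. *)
Definition mixed_lt (s t : seq N) (p d : nat) (u : tensor_power N p) : Prop :=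
  if d is d'.+1 then mixed s t d' u else u = 0.

Lemma mixed_ltW s t p d (u : tensor_power N p) : mixed_lt s t d u -> mixed s t d u.
Proof. by case: d => [->|d /mixedS //]; exact: mixed0. Qed.
Lemma mixed_lt0 s t p d : mixed_lt s t d (0 : tensor_power N p).
Proof. by case: d => [|d] //; exact: mixed0. Qed.
Lemma mixed_ltP s t p d c (u v : tensor_power N p) :
  mixed_lt s t d u -> mixed_lt s t d v -> mixed_lt s t d (c *: u + v).
Proof. by case: d => [-> ->|d]; [rewrite /= scaler0 addr0 | exact: mixedP]. Qed.
Lemma mixed_ltD s t p d (u v : tensor_power N p) :
  mixed_lt s t d u -> mixed_lt s t d v -> mixed_lt s t d (u + v).
Proof. by move=> su sv; rewrite -[u]scale1r; exact: mixed_ltP. Qed.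
Lemma mixed_lt_left s t p d x (u : tensor_power N p) :
  x \in s -> mixed_lt s t d u -> mixed_lt s t d.+1 (tcons x u).
Proof.
move=> xs; case: d => [->|d]; last exact: mixed_left.
by rewrite tcons0r; exact: mixed_lt0.
Qed.
Lemma mixed_lt_right s t p d y (u : tensor_power N p) :
  y \in t -> mixed_lt s t d u -> mixed_lt s t d (tcons y u).
Proof. by move=> yt; case: d => [->|d]; [exact: tcons0r | exact: mixed_right]. Qed.

Lemma mixed_span s t p d y (u : tensor_power N p) :
  in_span t y -> mixed s t d u -> mixed s t d (tcons y u).
Proof.
move=> ty su; apply: (ty (fun y => mixed s t d (tcons y u))) => [|c v w|v vt].
- by rewrite tcons0l; exact: mixed0.
- by rewrite tconsPl; exact: mixedP.
- exact: mixed_right.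
Qed.
Section Step.
Variables (s t t' : seq N).
Hypothesis tt' : {subset t <= t'}.

(** By the Leibniz rule each term of [a u] replaces one factor; it vanishes if that
    factor is in [t], and trades a factor in [s] for one in [t'] otherwise. *)
Lemma act_mixed (a : L) p d (u : tensor_power N p) :
  (forall x, x \in s -> in_span t' (lie_act a x)) ->
  (forall y, y \in t -> lie_act a y = 0) ->
  mixed s t d u -> mixed_lt s t' d (lie_act a u).
Proof.
move=> a_s a_t; elim=> {p d u} [d c|p d x u xs su IH|p d y u yt su IH|p d|p d c u v _ IHu _ IHv].
- exact: mixed_lt0.
- rewrite act_tcons; apply: mixed_ltD; last exact: mixed_lt_left.
  by apply: mixed_span; [exact: a_s | exact: mixed_sub su].
- by rewrite act_tcons a_t // tcons0l add0r; apply: mixed_lt_right => //; exact: tt'.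
- by rewrite lie_act0; exact: mixed_lt0.
- by rewrite lie_actP; exact: mixed_ltP.
Qed.

(** Operators that carry the vectors of [s] into the span of [t'] and back, and do
    not see [t]. Individually they move vectors of [s] out of [s], while their
    Casimir operator returns each of these vectors to its place. *)
Definition moving (ops : seq (L * L)) : Prop :=
  [/\ forall o x, o \in ops -> x \in s ->
        in_span t' (lie_act o.1 x) /\ in_span t' (lie_act o.2 x),
      forall o y, o \in ops -> y \in t -> lie_act o.1 y = 0 /\ lie_act o.2 y = 0
    & forall x, x \in s -> casimir ops x = x].

(** On a pure tensor with [d] factors in [s], the terms of [sum_o U_o D_o] in which
    [U_o] and [D_o] hit the same factor add up to multiplication by [d]; every
    other nonzero term has traded two factors in [s] for factors in [t']. *)
Lemma casimir_mixed ops p d (u : tensor_power N p) : moving ops ->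
  mixed s t d u -> mixed_lt s t' d (casimir ops u - d%:R *: u).
Proof.
move=> [ops_s ops_t ops1];
  elim=> {p d u} [d c|p d x u xs su IH|p d y u yt su IH|p d|p d c u v _ IHu _ IHv].
- case: d => [|d]; last exact: mixed_unit.
  by rewrite /= scale0r subr0 /casimir big1.
- have -> : casimir ops (tcons x u) - d.+1%:R *: tcons x u =
      \sum_(o <- ops) (tcons (lie_act o.2 x) (lie_act o.1 u)
                     + tcons (lie_act o.1 x) (lie_act o.2 u))
      + tcons x (casimir ops u - d%:R *: u).
    rewrite casimir_tcons ops1 // tconsBZ -natr1 scalerDl scale1r opprD.
    rewrite [tcons x u + _]addrC -!addrA; congr (_ + _).
    by rewrite addrCA [- _ - _]addrC addNKr.
  apply: mixed_ltD; last exact: mixed_lt_left.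
  rewrite big_seq; elim/big_ind: _ => [|v w|o oo]; [exact: mixed_lt0|exact: mixed_ltD|].
  have [o1 o2] := ops_s o x oo xs.
  have [a1 a2] : mixed_lt s t' d (lie_act o.1 u) /\ mixed_lt s t' d (lie_act o.2 u).
    by split; apply: act_mixed su => z zz;
      first [by have [] := ops_s o z oo zz | by have [] := ops_t o z oo zz].
  by apply: mixed_ltD; apply: mixed_span => //; exact: mixed_ltW.
- have -> : casimir ops (tcons y u) - d%:R *: tcons y u
      = tcons y (casimir ops u - d%:R *: u).
    rewrite casimir_tcons tconsBZ.
    have -> : casimir ops y = 0.
      by rewrite /casimir big_seq big1 // => o oo; rewrite (ops_t o y oo yt).2 lie_act0.
    rewrite tcons0l add0r big_seq big1 ?add0r // => o oo.
    by rewrite (ops_t o y oo yt).1 (ops_t o y oo yt).2 !tcons0l addr0.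
  by apply: mixed_lt_right => //; exact: tt'.
- rewrite scaler0 subr0 /casimir big1 => [|o _]; first exact: mixed_lt0.
  by rewrite !lie_act0.
- have -> : casimir ops (c *: u + v) - d%:R *: (c *: u + v)
     = c *: (casimir ops u - d%:R *: u) + (casimir ops v - d%:R *: v).
    rewrite casimir_linear scalerDr scalerBr opprD !scalerA mulrC.
    by rewrite addrACA.
  exact: mixed_ltP.
Qed.

End Step.
End Casimir.

(** * Bounded length of the tensor powers *)

Section TensorPowerRank.
Context (K : fieldType) (L : lieAlgType K) (N : lieModule L).
Hypothesis K0 : forall n, n.+1%:R != 0 :> K.

Fixpoint pures (t : seq N) (p : nat) : seq (tensor_power N p) :=
  if p is p'.+1 then [seq tcons y z | y <- t, z <- pures t p'] else [:: triv_one L].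

Lemma size_pures t p : size (pures t p) = (size t ^ p)%N.
Proof. by elim: p => //= p IH; rewrite size_allpairs IH expnS. Qed.

Lemma mixed_pures s t p (u : tensor_power N p) :
  mixed s t 0 u -> in_span (pures t p) u.
Proof.
move E : 0%N => d su.
elim: su E => {p d u} [d c|p d x u _ _ _|p d y u yt _ IH|p d|p d c u v _ IHu _ IHv] //
  E.
- have -> : c = (c : K) *: (triv_one L : tensor_power N 0) by exact/esym/mulr1.
  by apply: in_spanZ; apply: in_span_mem; exact: mem_head.
- apply: (IH E (fun u => in_span (pures t p.+1) (tcons y u))) => [|a v w|v vt].
  + by rewrite tcons0r.
  + by rewrite tconsPr; exact: in_spanP.
  + by apply: in_span_mem; exact: allpairs_f.
- exact: in_span0.
- exact: in_spanP (IHu E) (IHv E).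
Qed.

(** Vectors of [s] can be moved away repeatedly, each time through a fresh pair of
    vectors [q] and by operators blind to the pairs [t] chosen before. The
    predicate [adm] is the invariant of this process: in the examples it says
    that [t] is orthogonal to a dual system for [s]. *)
Definition movable : Prop :=
  forall s : seq N, exists2 adm : seq N -> Prop, adm [::] &
    forall t, adm t -> exists (q : N * N) (ops : seq (L * L)),
      adm [:: q.1, q.2 & t] /\ moving s t [:: q.1, q.2 & t] ops.

Lemma casimir_submodule (M : lieModule L) (A : submodule M) ops u :
  (forall o, o \in ops -> lie_act o.2 u \in A) -> casimir ops u \in A.
Proof.
by move=> Au; rewrite /casimir big_seq rpred_sum // => o /Au; exact: submodule_act.
Qed.

(** Up to [d] factors in [s] are moved out in [d] rounds. In each round [D_o u] and
    [C u - d u] have fewer factors in [s], where [C] is the Casimir operator, so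
    by induction they lie in [B]. Then [C u = sum_o U_o (D_o u)] lies in [B], and so
    does [d u]; here characteristic zero is used. The point is the size of [Z],
    which does not depend on [s]: only the pairs chosen on the way enter. *)
Lemma mixed_generated s (adm : seq N -> Prop) p :
  (forall t, adm t -> exists (q : N * N) (ops : seq (L * L)),
     adm [:: q.1, q.2 & t] /\ moving s t [:: q.1, q.2 & t] ops) ->
  forall d t, adm t -> exists2 Z : seq (tensor_power N p),
    size Z = ((size t + d.*2) ^ p)%N &
    forall A B : submodule (tensor_power N p),
      (forall z, in_span Z z -> z \in A -> z \in B) ->
      forall u, mixed s t d u -> u \in A -> u \in B.
Proof.
move=> adm_step; elim=> [|d IH] t adm_t.
  exists (pures t p); first by rewrite size_pures addn0.
  by move=> A B AB u /mixed_pures/AB.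
have [q [ops [adm_t' mv]]] := adm_step t adm_t.
have [Z szZ ZP] := IH _ adm_t'; exists Z.
  by rewrite szZ /= doubleS !addSn !addnS.
have tt' : {subset t <= [:: q.1, q.2 & t]} by move=> y yt; rewrite !inE yt !orbT.
move=> A B AB u su Au; have low := ZP A B AB.
have Du o : o \in ops -> lie_act o.2 u \in B.
  move=> oo; apply: low; last exact: submodule_act.
  have [mv1 mv2 _] := mv; apply: (act_mixed tt' _ _ su) => z zz.
    by have [] := mv1 o z oo zz.
  by have [] := mv2 o z oo zz.
have CuB : casimir ops u \in B by exact: casimir_submodule.
have CuA : casimir ops u \in A by apply: casimir_submodule => o _; exact: submodule_act.
have eB : casimir ops u - d.+1%:R *: u \in B.
  by apply: low; [exact: (casimir_mixed tt' mv su) | apply: submoduleB; rewrite ?rpredZ].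
have -> : u = (d.+1%:R)^-1 *: (casimir ops u - (casimir ops u - d.+1%:R *: u)).
  by rewrite opprB addrC subrK scalerA mulVf // scale1r.
by rewrite rpredZ //; exact: submoduleB.
Qed.

(** Each step of a strict chain of submodules is witnessed by one tensor. These
    tensors involve finitely many vectors [s], so the steps remain strict after
    intersection with the span of [Z], whose dimension is bounded in terms of [p]
    alone. *)
Lemma ranked_tensor_power p : movable -> ranked (tensor_power N p).
Proof.
move=> mv; apply: (@bounded_chains_ranked _ _ _ (p.*2 ^ p)) => c l cP.
have wit i : exists u, (i < l)%N -> u \in c i.+1 /\ u \notin c i.
  have [il|h] := pselect (i < l)%N; last by exists 0 => /h.
  by have [_ [u u1 u2]] := cP i il; exists u.
pose a i := sval (cid (wit i)).
have aP i : (i < l)%N -> a i \in c i.+1 /\ a i \notin c i by exact: (svalP (cid (wit i))).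
have [s sP] := mixed_exists_all l a.
have [adm adm0 adm_step] := mv s.
have [Z szZ ZP] := mixed_generated p adm_step p adm0.
have wit' i : exists z, (i < l)%N -> [/\ in_span Z z, z \in c i.+1 & z \notin c i].
  have [il|h] := pselect (i < l)%N; last by exists 0 => /h.
  have [Aa nAa] := aP i il; apply: contrapT => h.
  move/negP: nAa; apply; apply: (ZP _ _ _ (a i) (sP i il) Aa) => z Zz Az.
  by apply/negPn/negP => nz; apply: h; exists z.
pose z i := sval (cid (wit' i)).
have zP i : (i < l)%N -> [/\ in_span Z (z i), z i \in c i.+1 & z i \notin c i].
  exact: (svalP (cid (wit' i))).
rewrite -[p.*2]add0n -szZ; apply: (span_chain_bound _ zP) => i j.
elim: j => [|j IH]; first by rewrite leqn0 => /eqP ->.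
rewrite leq_eqVlt => /predU1P[-> //|ij jl u ui].
by apply: (cP j jl).1; apply: IH ui => //; exact: ltnW.
Qed.

End TensorPowerRank.

(** * Exactness of the tensor product *)

Section Retraction.
Context (K : fieldType) (M X : lmodType K) (i : {linear M -> X}).

(** The graph of a linear map to [M] from a subspace of [X] containing [i M], which
    inverts [i] there. The last clause is conditional so that the empty relation,
    which is the union of the empty chain, is included. *)
Definition partial_retraction (G : set (X * M)) : Prop :=
  [/\ forall c x m y n, G (x, m) -> G (y, n) -> G (c *: x + y, c *: m + n),
      forall m, G (0, m) -> m = 0
    & forall u, G u -> forall m, G (i m, m)].

(** By Zorn's lemma there is a maximal partial retraction [E]; if it were undefined
    at [x], sending [x] to [0] would extend it. *)
Lemma linear_retraction : injective i -> exists r : {linear X -> M}, cancel i r.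
Proof.
move=> i_inj.
have i0 m : i m = 0 -> m = 0 by rewrite -(raddf0 i) => /i_inj.
have [F FP Ftot|E [[Elin Efun Egr] Emax]] := @Zorn_bigcup (X * M) partial_retraction.
  split=> [c x m y n [G1 F1 G1x] [G2 F2 G2y]|m [G FG G0]|u].
    have {}[G [FG Gx Gy]] : exists G, [/\ F G, G (x, m) & G (y, n)].
      by have [s|s] := Ftot _ _ F1 F2; [exists G2 | exists G1]; split=> //; exact: s.
    by exists G => //; have [Glin _ _] := FP G FG; exact: Glin.
    by have [_ Gfun _] := FP G FG; exact: Gfun.
  by move=> [G FG Gu] m; exists G => //; have [_ _ Ggr] := FP G FG; exact: Ggr Gu m.
have Ei m : E (i m, m).
  have [[u Eu]|nE] := pselect (exists u, E u); first exact: Egr Eu m.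
  case: (Emax (fun u : X * M => i u.2 = u.1)).
    split=> [u Eu|sub]; first by case: nE; exists u.
    by apply: nE; exists (i 0, 0); exact: sub.
  split=> [c x n y k /= <- <-|n /= /i0 //|u _ n //].
  by rewrite linearP.
have Etot x : exists m, E (x, m).
  apply: contrapT => nx; pose G (u : X * M) : Prop := exists c y m, E (y, m) /\ u = (y + c *: x, m).
  have EG : (E `<=` G)%classic.
    by move=> [y m] Eu; exists 0, y, m; rewrite scale0r addr0.
  apply: (Emax G); first split=> // GE.
    have /GE Ex0 : G (x, 0).
      by exists 1, (i 0), 0; split; [exact: Ei | rewrite raddf0 add0r scale1r].
    by apply: nx; exists 0.
  split=> [c y m z n [a [y' [m' [E1 [-> ->]]]]] [b [z' [n' [E2 [-> ->]]]]]|m|u _ m].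
  - exists (c * a + b), (c *: y' + z'), (c *: m' + n'); split; first exact: Elin.
    by rewrite scalerDr scalerDl scalerA addrACA.
  - move=> [c [y [m' [Ey e]]]]; case: e => e ->.
    have [c0|c0] := eqVneq c 0.
      by move: e; rewrite c0 scale0r addr0 => y0; apply: Efun; rewrite y0.
    case: nx; exists ((- c^-1) *: m' + 0).
    have -> : x = (- c^-1) *: y + i 0.
      move/eqP: e; rewrite eq_sym addr_eq0 => /eqP ->.
      by rewrite scaleNr scalerN opprK scalerA mulVf // scale1r raddf0 addr0.
    by apply: Elin Ey _; exact: Ei.
  - by apply: EG; exact: Ei.
pose r x := sval (cid (Etot x)).
have rP x : E (x, r x) by exact: (svalP (cid (Etot x))).
have uniq x m n : E (x, m) -> E (x, n) -> m = n.
  move=> E1 E2; apply/eqP; rewrite eq_sym -subr_eq0; apply/eqP/Efun.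
  by have := Elin (-1) _ _ _ _ E1 E2; rewrite !scaleN1r addNr addrC.
have lr : linear r by move=> c x y; apply: uniq (rP _) _; exact: Elin.
exists (linear_of lr) => m; exact: uniq (rP _) (Ei m).
Qed.

End Retraction.

Section TensorExact.
Context (K : fieldType) (L : lieAlgType K).
Implicit Types M N X Y : lieModule L.

(** Vector spaces are flat: a linear retraction of [f] induces one of [f (x) id]. *)
Lemma tensor_map_inj M X N (f : lie_hom M X) :
  injective f -> injective (tensor_map f (lie_id N)).
Proof.
move=> /linear_retraction[r rK].
pose b (x : X) (n : N) : tensor M N := tens (r x) n.
have bb : is_bilinear b by apply: is_bilinearI => c u v w; rewrite /b ?linearP ?tensPl ?tensPr.
apply: (can_inj (g := tens_lift b)).
apply: tensor_linear_ext => [c u v|//|m n].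
  by rewrite linearP; exact: (tens_lift_linear bb).
by rewrite tensor_mapE tens_liftE // /b rK.
Qed.

Lemma tensor_map_surj M X N (q : lie_hom X M) :
  (forall m, exists u, q u = m) ->
  forall w, exists u, tensor_map q (lie_id N) u = w.
Proof.
move=> q_surj w; rewrite [w]tensor_sum.
elim/big_ind: _ => [|_ _ [u <-] [v <-]|[m n] _ /=]; first by exists 0; exact: raddf0.
  by exists (u + v); exact: raddfD.
by have [u <-] := q_surj m; exists (tens u n); exact: tensor_mapE.
Qed.

Definition swap_fun M N (m : M) (n : N) : tensor_module N M := tens n m.
Lemma swap_bilinear M N : is_bilinear (@swap_fun M N).
Proof. by apply: is_bilinearI => c u v w; rewrite /swap_fun ?tensPl ?tensPr. Qed.
Lemma swap_act M N (x : L) (m : M) (n : N) :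
  swap_fun (lie_act x m) n + swap_fun m (lie_act x n) = lie_act x (swap_fun m n).
Proof. by rewrite [RHS]lie_act_tens addrC. Qed.
Definition tensor_swap M N : lie_hom (tensor_module M N) (tensor_module N M) :=
  tensor_hom_lift (@swap_bilinear M N) (@swap_act M N).
Lemma tensor_swapE M N (m : M) (n : N) : tensor_swap M N (tens m n) = tens n m.
Proof. exact: tensor_hom_liftE. Qed.
Lemma tensor_swapK M N : cancel (tensor_swap M N) (tensor_swap N M).
Proof.
have -> : cancel (tensor_swap M N) (tensor_swap N M) =
  (lie_comp (tensor_swap N M) (tensor_swap M N) =1 lie_id (tensor_module M N)) by [].
move=> u; congr (lie_hom_fun _ u).
by apply: tensor_hom_ext => m n; rewrite lie_compE !tensor_swapE.
Qed.

Section DsumTensor.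
Variables M M' N : lieModule L.
Definition dsum2_tensor :=
  hom_pair (tensor_map (dsum2_fst M M') (lie_id N)) (tensor_map (dsum2_snd M M') (lie_id N)).
Lemma dsum2_tensor_inj : injective dsum2_tensor.
Proof.
pose g (u : dsum2 (tensor_module M N) (tensor_module M' N)) : tensor_module (dsum2 M M') N :=
  tensor_map (dsum2_inl M M') (lie_id N) u.1 + tensor_map (dsum2_inr M M') (lie_id N) u.2.
have lg : linear g.
  move=> c u v; rewrite /g -[(_ + _).1]/(c *: u.1 + v.1) -[(_ + _).2]/(c *: u.2 + v.2).
  by rewrite !linearP scalerDr addrACA.
have gE m n : g (dsum2_tensor (tens m n)) = tens m n.
  rewrite /g [(dsum2_tensor _).1]tensor_mapE [(dsum2_tensor _).2]tensor_mapE !tensor_mapE.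
  rewrite -[tens _ _]scale1r -tensPl scale1r.
  by case: m => a b; congr (tens (_, _) _); rewrite /= ?addr0 ?add0r.
apply: (can_inj (g := g)); apply: tensor_linear_ext => [c u v|//|m n]; last exact: gE.
by rewrite linearP lg.
Qed.
End DsumTensor.

End TensorExact.

(** * The objects of the tensor category *)

Section DirectSumHoms.
Context (K : fieldType) (L : lieAlgType K) (I : eqType) (M : I -> lieModule L).

Lemma dsum_proj_linear i : linear (fun u : dsum M => (sval u : lie_family M) i : M i).
Proof. by []. Qed.
Definition dsum_proj i : lie_hom (dsum M) (M i) :=
  @lie_hom_of K L (dsum M) (M i) _ (@dsum_proj_linear i) (fun _ _ => erefl).

Lemma dsum_ext (u v : dsum M) : (forall i, dsum_proj i u = dsum_proj i v) -> u = v.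
Proof. by move=> e; apply/val_inj/functional_extensionality_dep. Qed.

Lemma dsum_finsupp (u : dsum M) :
  exists s : seq I, forall i, i \notin s -> dsum_proj i u = 0.
Proof. exact/asboolP/(svalP u). Qed.

Section Lift.
Variables (Y : lieModule L) (f : forall i, lie_hom Y (M i)).
Hypothesis fin : forall y, exists s : seq I, forall i, i \notin s -> f i y = 0.

Definition dsum_lift_fun (y : Y) : dsum M :=
  exist (fun g : lie_family M => g \in @finsupp K L I M) (fun i => f i y)
    (asboolT (fin y)).
Lemma dsum_lift_linear : linear dsum_lift_fun.
Proof. by move=> c u v; apply: dsum_ext => i; exact: linearP. Qed.
Lemma dsum_lift_act (x : L) y : dsum_lift_fun (lie_act x y) = lie_act x (dsum_lift_fun y).
Proof. by apply: dsum_ext => i; exact: lie_hom_act. Qed.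
Definition dsum_lift : lie_hom Y (dsum M) :=
  @lie_hom_of K L Y (dsum M) _ dsum_lift_linear dsum_lift_act.
Lemma dsum_liftE i y : dsum_proj i (dsum_lift y) = f i y.
Proof. by []. Qed.
End Lift.

Section Inj.
Variable k : I.
(** The transport along [k = j] is confined to this Kronecker-delta family of
    homomorphisms. *)
Definition dsum_inj_comp j : lie_hom (M k) (M j) :=
  if k =P j is ReflectT e then eq_rect k (fun j => lie_hom (M k) (M j)) (lie_id _) j e
  else hom_zero _ _.
Lemma dsum_inj_fin (y : M k) :
  exists s : seq I, forall i, i \notin s -> dsum_inj_comp i y = 0.
Proof.
exists [:: k] => i; rewrite inE eq_sym /dsum_inj_comp => /negP ne.
by case: eqP => // e; case: ne; apply/eqP.
Qed.
Definition dsum_inj : lie_hom (M k) (dsum M) := dsum_lift dsum_inj_fin.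
Lemma dsum_inj_inj : injective dsum_inj.
Proof.
move=> u v /(congr1 (dsum_proj k)); rewrite !dsum_liftE /dsum_inj_comp.
by case: eqP => // e; rewrite (eq_axiomK e).
Qed.
End Inj.

End DirectSumHoms.

Section Tensorial.
Context (K : fieldType) (L : lieAlgType K) (N : lieModule L).
Implicit Types M X Y : lieModule L.

(** The closure of the tensor powers of [N] under finite sums, submodules and
    quotients. For movable [N] it is the class of objects of the tensor category;
    every property needed of these objects is stable under the four rules. *)
Inductive tensorial : lieModule L -> Prop :=
| tensorial_power k : tensorial (tensor_power N k)
| tensorial_sum M X : tensorial M -> tensorial X -> tensorial (dsum2 M X)
| tensorial_sub M X (f : lie_hom M X) : injective f -> tensorial X -> tensorial M
| tensorial_quot X M (q : lie_hom X M) :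
    (forall m, exists u, q u = m) -> tensorial X -> tensorial M.

Lemma iso_inj M X (f : lie_hom M X) : @is_iso (lie_category L) M X f -> injective f.
Proof.
move=> [g [gf _]]; apply: (can_inj (g := g)) => m.
by rewrite -[g (f m)]/(lie_comp g f m) [lie_comp g f]gf.
Qed.

Lemma tensor_map_injr M X Y (f : lie_hom M X) :
  injective f -> injective (tensor_map (lie_id Y) f).
Proof.
move=> f_inj.
have -> : tensor_map (lie_id Y) f
    = lie_comp (tensor_swap X Y) (lie_comp (tensor_map f (lie_id Y)) (tensor_swap Y M)).
  apply: tensor_hom_ext => y m.
  by rewrite !lie_compE !tensor_mapE tensor_swapE tensor_mapE tensor_swapE.
move=> u v /(can_inj (@tensor_swapK _ _ X Y)) /(tensor_map_inj f_inj).
exact: (can_inj (@tensor_swapK _ _ Y M)).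
Qed.

Lemma tensor_power_cat k l :
  exists f : lie_hom (tensor_module (tensor_power N k) (tensor_power N l))
                     (tensor_power N (k + l)), injective f.
Proof.
elim: k => [|k [f f_inj]].
  by exists (tensor_lunit (tensor_power N l)); exact: iso_inj (tensor_lunit_iso _).
exists (lie_comp (tensor_map (lie_id N) f) (tensor_assoc N (tensor_power N k) (tensor_power N l))).
by move=> u v /(tensor_map_injr f_inj); exact: iso_inj (tensor_assoc_iso _ _ _) _ _.
Qed.

Lemma tensorial_swap M X :
  tensorial (tensor_module M X) -> tensorial (tensor_module X M).
Proof. exact: tensorial_sub (can_inj (@tensor_swapK _ _ X M)). Qed.

(** The four rules are compatible with [- (x) X], so that both factors reduce to
    tensor powers. *)
Lemma tensorial_tensor M X : tensorial M -> tensorial X -> tensorial (tensor_module M X).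
Proof.
move=> tM; elim: tM X => {M} [k|M M' _ IH _ IH'|M Y f f_inj _ IH|Y M q q_surj _ IH] X tX.
- apply: tensorial_swap.
  elim: tX => {X} [l|M M' _ IH _ IH'|M Y f f_inj _ IH|Y M q q_surj _ IH].
  + by have [f f_inj] := tensor_power_cat l k; exact: tensorial_sub f_inj (tensorial_power _).
  + exact: tensorial_sub (@dsum2_tensor_inj _ _ M M' _) (tensorial_sum IH IH').
  + exact: tensorial_sub (tensor_map_inj f_inj) IH.
  + exact: tensorial_quot (tensor_map_surj q_surj) IH.
- exact: tensorial_sub (@dsum2_tensor_inj _ _ M M' _) (tensorial_sum (IH X tX) (IH' X tX)).
- exact: tensorial_sub (tensor_map_inj f_inj) (IH X tX).
- exact: tensorial_quot (tensor_map_surj q_surj) (IH X tX).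
Qed.

Lemma tensorial_ranked M :
  (forall n, n.+1%:R != 0 :> K) -> movable N -> tensorial M -> ranked M.
Proof.
move=> K0 mv; elim=> {M} [k|M X _ IH _ IH'|M X f f_inj _|X M q q_surj _].
- exact: ranked_tensor_power.
- exact: ranked_dsum2.
- exact: ranked_inj f_inj.
- exact: ranked_surj q_surj.
Qed.

Lemma tensorial_joint Y (J : finType) (k : J -> nat)
    (h : forall j, lie_hom Y (tensor_power N (k j))) :
  (forall y, (forall j, h j y = 0) -> y = 0) -> tensorial Y.
Proof.
move=> joint.
suff [F tF [f fP]] : exists2 F, tensorial F & exists f : lie_hom Y F,
    forall y, f y = 0 -> forall j, j \in enum J -> h j y = 0.
  apply: (@tensorial_sub Y F f _ tF) => u v e.
  apply/eqP; rewrite -subr_eq0; apply/eqP/joint => j; apply: fP; rewrite ?mem_enum //.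
  by rewrite linearB /= e subrr.
elim: (enum J) => [|i s [F tF [f fP]]].
  by exists (tensor_power N 0); [exact: tensorial_power | exists (hom_zero _ _)].
exists (dsum2 (tensor_power N (k i)) F); first exact: tensorial_sum (tensorial_power _) tF.
exists (hom_pair (h i) f) => y [e1 e2] j; rewrite inE => /predU1P[->|] //; exact: fP.
Qed.

Definition joint_kernel Y (J : Type) (Z : J -> lieModule L)
  (f : forall j, lie_hom Y (Z j)) (D : J -> Prop) : submodule Y.
Proof.
refine (@submodule_of K L Y (fun y => forall j, D j -> f j y = 0) _ _ _).
- by move=> j _; exact: raddf0.
- by move=> c u v fu fv j Dj; rewrite linearP fu // fv // scaler0 addr0.
- by move=> x u fu j Dj; rewrite lie_hom_act fu // lie_act0.
Defined.
Lemma joint_kernelP Y (J : Type) (Z : J -> lieModule L)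
    (f : forall j, lie_hom Y (Z j)) (D : J -> Prop) y :
  (y \in joint_kernel f D) <-> (forall j, D j -> f j y = 0).
Proof. exact: submodule_ofP. Qed.

Definition algebra_sum_comp n (jk : 'I_n * nat) :
    lie_hom (tensor_algebra_sum N n) (tensor_power N jk.2) :=
  lie_comp (dsum_proj (tensor_power N) jk.2)
    (dsum_proj (fun _ : 'I_n => tensor_algebra N) jk.1).

Lemma algebra_sum_bounded n (u : tensor_algebra_sum N n) :
  exists b, forall jk, (b <= jk.2)%N -> algebra_sum_comp jk u = 0.
Proof.
have bdj (j : 'I_n) : exists b, forall k, (b <= k)%N -> algebra_sum_comp (j, k) u = 0.
  have [t tP] := dsum_finsupp (dsum_proj (fun _ : 'I_n => tensor_algebra N) j u).
  exists (\max_(k <- t) k).+1 => k; rewrite ltnNge => lek; apply: tP.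
  by apply: contra lek => kt; exact: leq_bigmax_seq.
exists (\max_j sval (cid (bdj j))) => -[j k] /= /(leq_trans (leq_bigmax j)).
exact: (svalP (cid (bdj j))).
Qed.

(** Lifts to [Q] of finitely many generators of [M] involve finitely many tensor
    degrees. The submodule [S] of [Q] of elements confined to these degrees still
    maps onto [M], and it embeds into a finite sum of tensor powers. *)
Lemma tensorial_of_obj M : tensor_category_obj N M -> tensorial M.
Proof.
move=> [/finite_length_gen[s sgen] [n [_ /is_subquotientP[Q [i [q [i_inj q_surj]]]]]]].
have [b bP] : exists b, forall x, x \in s -> exists2 u, q u = x &
    forall jk, (b <= jk.2)%N -> algebra_sum_comp jk (i u) = 0.
  elim: (s) => [|x t [b bP]]; first by exists 0%N.
  have [u qu] := q_surj x; have [b' b'P] := algebra_sum_bounded (i u).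
  exists (maxn b b') => y; rewrite inE => /predU1P[->|/bP[v qv vP]].
    by exists u => // jk; rewrite geq_max => /andP[_]; exact: b'P.
  by exists v => // jk; rewrite geq_max => /andP[+ _]; exact: vP.
pose S := joint_kernel (fun jk => lie_comp (algebra_sum_comp jk) i) (fun jk => b <= jk.2)%N.
apply: (@tensorial_quot (sub_module S) M (lie_comp q (sub_incl S))) => [m|].
  have : m \in hom_image (lie_comp q (sub_incl S)) (submodule_full _).
    apply: sgen => x /bP[u qu uP]; have Su : u \in S by apply/joint_kernelP.
    by apply/hom_imageP; exists (exist _ u Su); rewrite ?submodule_fullP.
  by move=> /hom_imageP[u _ e]; exists u.
pose h (jk : 'I_n * 'I_b) : lie_hom (sub_module S) (tensor_power N jk.2) :=
  lie_comp (algebra_sum_comp (jk.1, nat_of_ord jk.2)) (lie_comp i (sub_incl S)).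
apply: (tensorial_joint (h := h)) => u u0.
apply: sub_incl_inj; rewrite raddf0; apply: i_inj; rewrite raddf0.
apply: dsum_ext => j; rewrite raddf0; apply: dsum_ext => k; rewrite raddf0.
have [bk|kb] := leqP b k; last exact: (u0 (j, Ordinal kb)).
by have /joint_kernelP/(_ (j, k) bk) := svalP u.
Qed.

Lemma subquotient_dsum2 M X M' X' :
  subquotient M X -> subquotient M' X' -> subquotient (dsum2 M M') (dsum2 X X').
Proof.
move=> [Q [i [q [i_inj q_surj]]]] [Q' [i' [q' [i'_inj q'_surj]]]].
exists (dsum2 Q Q'), (hom_pair (lie_comp i (dsum2_fst _ _)) (lie_comp i' (dsum2_snd _ _))),
  (hom_pair (lie_comp q (dsum2_fst _ _)) (lie_comp q' (dsum2_snd _ _))).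
split=> [[u u'] [v v'] [/i_inj -> /i'_inj ->] //|[m m']].
by have [u <-] := q_surj m; have [u' <-] := q'_surj m'; exists (u, u').
Qed.

Lemma subquotient_inj M X Y (f : lie_hom X Y) :
  injective f -> subquotient M X -> subquotient M Y.
Proof.
move=> f_inj [Q [i [q [i_inj q_surj]]]].
by exists Q, (lie_comp f i), q; split=> // u v /f_inj/i_inj.
Qed.

Lemma subquotient_quot M X Y (p : lie_hom M Y) :
  (forall m, exists u, p u = m) -> subquotient M X -> subquotient Y X.
Proof.
move=> p_surj [Q [i [q [i_inj q_surj]]]].
exists Q, i, (lie_comp p q); split=> // y.
by have [m <-] := p_surj y; have [u <-] := q_surj m; exists u.
Qed.

(** The new span is the pullback of [Q -> M <- Y]. *)
Lemma subquotient_sub M X Y (f : lie_hom Y M) :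
  injective f -> subquotient M X -> subquotient Y X.
Proof.
move=> f_inj [Q [i [q [i_inj q_surj]]]].
pose S := hom_preimage q (hom_image f (submodule_full Y)).
have SP (u : sub_module S) : exists y, f y = q (sub_incl S u).
  by have /hom_preimageP/hom_imageP[y _ e] := svalP u; exists y.
pose p u := sval (cid (SP u)).
have pP u : f (p u) = q (sub_incl S u) by exact: (svalP (cid (SP u))).
have lp : linear p by move=> c u v; apply: f_inj; rewrite linearP !pP !linearP.
have ap (x : L) u : p (lie_act x u) = lie_act x (p u).
  by apply: f_inj; rewrite lie_hom_act !pP !lie_hom_act.
exists (sub_module S), (lie_comp i (sub_incl S)), (lie_hom_of lp ap).
split=> [u v /i_inj/sub_incl_inj //|y].
have [u qu] := q_surj (f y).
have Su : u \in S.
  by apply/hom_preimageP/hom_imageP; exists y; rewrite ?submodule_fullP.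
by exists (exist _ u Su); apply: f_inj; rewrite -qu; exact: pP.
Qed.

Lemma algebra_sum_cat n m : exists f : lie_hom
  (dsum2 (tensor_algebra_sum N n) (tensor_algebra_sum N m)) (tensor_algebra_sum N (n + m)),
  injective f.
Proof.
pose T := tensor_algebra N.
pose Y := dsum2 (tensor_algebra_sum N n) (tensor_algebra_sum N m).
pose f (i : 'I_(n + m)) : lie_hom Y T := match fintype.split i with
  | inl j => lie_comp (dsum_proj (fun _ : 'I_n => T) j) (dsum2_fst _ _)
  | inr j => lie_comp (dsum_proj (fun _ : 'I_m => T) j) (dsum2_snd _ _) end.
have fin y : exists s : seq 'I_(n + m), forall i, i \notin s -> f i y = 0.
  by exists (enum 'I_(n + m)) => i; rewrite mem_enum.
exists (dsum_lift (M := fun _ : 'I_(n + m) => T) fin) => u v e.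
have fe i : f i u = f i v by exact: (congr1 (dsum_proj (fun _ : 'I_(n + m) => T) i) e).
have e1 : u.1 = v.1.
  by apply: dsum_ext => j; have := fe (unsplit (inl j)); rewrite /f unsplitK.
have e2 : u.2 = v.2.
  by apply: dsum_ext => j; have := fe (unsplit (inr j)); rewrite /f unsplitK.
by case: u v e1 e2 {e fe} => [u1 u2] [v1 v2] /= -> ->.
Qed.

Lemma tensorial_subquotient M : tensorial M ->
  exists n, (0 < n)%N /\ subquotient M (tensor_algebra_sum N n).
Proof.
elim=> {M} [k|M X _ [n [n0 sn]] _ [m [m0 sm]]|M X f f_inj _ [n [n0 sn]]|X M q q_surj _ [n [n0 sn]]].
- exists 1%N; split=> //; exists (tensor_power N k).
  exists (lie_comp (@dsum_inj K L 'I_1 (fun=> tensor_algebra N) 0)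
    (@dsum_inj K L nat (tensor_power N) k)), (lie_id _).
  split=> [u v /dsum_inj_inj/dsum_inj_inj //|m]; by exists m.
- exists (n + m)%N; split; first by rewrite addn_gt0 n0.
  have [f f_inj] := algebra_sum_cat n m.
  exact: subquotient_inj f_inj (subquotient_dsum2 sn sm).
- by exists n; split=> //; exact: subquotient_sub f_inj sn.
- by exists n; split=> //; exact: subquotient_quot q_surj sn.
Qed.

Hypothesis K0 : forall n, n.+1%:R != 0 :> K.
Hypothesis mv : movable N.

Lemma tensor_category_objP M : tensor_category_obj N M <-> tensorial M.
Proof.
split=> [|tM]; first exact: tensorial_of_obj.
split; first exact/ranked_finite_length/tensorial_ranked.
have [n [n0 sn]] := tensorial_subquotient tM.
by exists n; split=> //; apply/is_subquotientP.
Qed.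

(** In the class of objects the condition of finite length has become automatic,
    and only the subquotient condition has to be followed through tensor products. *)
Lemma movable_closed : tensor_category_closed N.
Proof.
split=> [|M X /tensor_category_objP tM /tensor_category_objP tX].
  exact/tensor_category_objP/(tensorial_power 0).
exact/tensor_category_objP/tensorial_tensor.
Qed.

End Tensorial.

(** * Restriction to a dense subalgebra *)

Section FullyFaithful.
Local Open Scope cat_scope.
Local Notation hom := Defs.hom.
Local Notation fmap := Defs.fmap.

Lemma fully_faithful_equivalence (C D : category) (F : functor C D) :
  (forall a b (g : hom (F a) (F b)), exists f, fmap F f = g) ->
  (forall a b (f f' : hom a b), fmap F f = fmap F f' -> f = f') ->
  (forall d, exists c (f : hom (F c) d), is_iso f) ->
  is_equivalence F.
Proof.
move=> full faithful ess.
pose lift a b (g : hom (F a) (F b)) := sval (cid (full a b g)).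
have liftK a b g : fmap F (@lift a b g) = g by exact: (svalP (cid (full a b g))).
pose G0 d := sval (cid (ess d)).
have essG d : exists f : hom (F (G0 d)) d, is_iso f by exact: (svalP (cid (ess d))).
pose e d := sval (cid (essG d)).
have e_iso d : is_iso (e d) by exact: (svalP (cid (essG d))).
pose e' d := sval (cid (e_iso d)).
have ee' d : e d \; e' d = idm _ by exact: (svalP (cid (e_iso d))).1.
have e'e d : e' d \; e d = idm _ by exact: (svalP (cid (e_iso d))).2.
have e'eK d x (f : hom d x) : e' d \; (e d \; f) = f by rewrite -compmA e'e compm1r.
pose G1 a b (f : hom a b) : hom (G0 a) (G0 b) := lift _ _ (e a \; f \; e' b).
have G11 a : G1 a a (idm a) = idm (G0 a).
  by apply: faithful; rewrite liftK compm1r ee' fmap1.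
have G1M a b c (f : hom a b) (g : hom b c) : G1 a c (f \; g) = G1 a b f \; G1 b c g.
  by apply: faithful; rewrite fmapM !liftK !compmA e'eK.
exists (Functor G11 G1M); split.
  exists (fun a => lift _ _ (e' (F a))); split=> [a|a b f].
    exists (lift _ _ (e (F a))).
    by split; apply: faithful; rewrite fmapM !liftK fmap1.
  by apply: faithful; rewrite !fmapM !liftK e'eK.
by exists e; split=> // a b f; rewrite /= liftK !compmA e'e compm1l.
Qed.
End FullyFaithful.

Section RestrictHom.
Context (K : fieldType) (L : lieAlgType K) (A : lie_subalgebra L).
Implicit Types M X : lieModule L.
Local Notation res := (lie_restrict A).

Lemma res_hom_linear M X (f : lie_hom M X) : linear (f : res M -> res X).
Proof. exact: linearP. Qed.
Definition res_hom M X (f : lie_hom M X) : lie_hom (res M) (res X) :=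
  @lie_hom_of K _ (res M) (res X) f (res_hom_linear f)
    (fun x m => lie_hom_act f (lie_sub_val x) m).

Lemma res_tensor_linear M X :
  linear (fun u : tensor_module (res M) (res X) => u : res (tensor_module M X)).
Proof. by []. Qed.
Lemma res_tensor_act M X (x : lie_sub A) (u : tensor_module (res M) (res X)) :
  (lie_act x u : res (tensor_module M X))
    = lie_act x (u : res (tensor_module M X)).
Proof. by []. Qed.
(** Restriction does not change the underlying spaces of tensor products, nor the
    action on them, so its structure maps are identities. *)
Definition res_tensor M X :
    lie_hom (tensor_module (res M) (res X)) (res (tensor_module M X)) :=
  @lie_hom_of K _ _ (res (tensor_module M X)) _
    (@res_tensor_linear M X) (@res_tensor_act M X).
Definition unres_tensor M X :
    lie_hom (res (tensor_module M X)) (tensor_module (res M) (res X)) :=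
  @lie_hom_of K _ (res (tensor_module M X)) (tensor_module (res M) (res X)) id
    (@res_tensor_linear M X) (fun x u => esym (@res_tensor_act M X x u)).
Lemma res_tensor_iso M X : @is_iso (lie_category _) _ _ (res_tensor M X).
Proof. by exists (unres_tensor M X); split; apply: lie_hom_ext. Qed.

Lemma res_unit_linear :
  linear (fun u : triv_module (lie_sub A) => u : res (triv_module L)).
Proof. by []. Qed.
Definition res_unit : lie_hom (triv_module (lie_sub A)) (res (triv_module L)) :=
  @lie_hom_of K _ _ (res (triv_module L)) _ res_unit_linear (fun _ _ => erefl).
Definition unres_unit : lie_hom (res (triv_module L)) (triv_module (lie_sub A)) :=
  @lie_hom_of K _ (res (triv_module L)) (triv_module (lie_sub A)) id
    res_unit_linear (fun _ _ => erefl).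
Lemma res_unit_iso : @is_iso (lie_category _) _ _ res_unit.
Proof. by exists unres_unit; split; apply: lie_hom_ext. Qed.

End RestrictHom.

Section Isos.
Context (K : fieldType) (L : lieAlgType K).
Implicit Types M X : lieModule L.

Lemma is_isoP M X (f : lie_hom M X) :
  @is_iso (lie_category L) _ _ f <->
  exists g : lie_hom X M, cancel f g /\ cancel g f.
Proof.
split=> [[g [gf fg]]|[g [gK fK]]]; exists g; last by split; exact: lie_hom_ext.
split=> u; first exact: (congr1 (fun h : lie_hom _ _ => h u) gf).
exact: (congr1 (fun h : lie_hom _ _ => h u) fg).
Qed.

Lemma bij_iso M X (f : lie_hom M X) :
  injective f -> (forall x, exists m, f m = x) -> @is_iso (lie_category _) _ _ f.
Proof. by move=> f_inj f_surj; apply/is_isoP; exact: lie_hom_inverse. Qed.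

Lemma lie_comp_iso M M' X (f : lie_hom M M') (g : lie_hom M' X) :
  @is_iso (lie_category _) _ _ f -> @is_iso (lie_category _) _ _ g ->
  @is_iso (lie_category _) _ _ (lie_comp g f).
Proof.
move=> /is_isoP[f' [fK fK']] /is_isoP[g' [gK gK']].
apply/is_isoP; exists (lie_comp f' g').
by split=> u; rewrite !lie_compE ?gK ?fK ?fK' ?gK'.
Qed.

Lemma tensor_map_iso M M' X X' (f : lie_hom M M') (g : lie_hom X X') :
  @is_iso (lie_category _) _ _ f -> @is_iso (lie_category _) _ _ g ->
  @is_iso (lie_category _) _ _ (tensor_map f g).
Proof.
move=> [f' [ff' f'f]] [g' [gg' g'g]]; exists (tensor_map f' g'); split.
  exact: (etrans (esym (tensor_mapM f f' g g')) (etrans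
    (congr2 (@tensor_map _ _ _ _ _ _) ff' gg') (tensor_map1 M X))).
exact: (etrans (esym (tensor_mapM f' f g' g)) (etrans
  (congr2 (@tensor_map _ _ _ _ _ _) f'f g'g) (tensor_map1 M' X'))).
Qed.
End Isos.

Section Dense.
Context (K : fieldType) (L : lieAlgType K) (A : lie_subalgebra L) (N : lieModule L).
Implicit Types M X : lieModule L.
Local Notation res := (lie_restrict A).

(** Density on [M] and density on [X] do not by themselves give simultaneous
    density, hence not density on [M (x) X] either. Reducing every finite set of
    conditions on [x] to one on the single module [N] avoids this. *)
Definition controlled M : Prop :=
  forall m : M, exists s : seq N,
    forall x : L, (forall r, r \in s -> lie_act x r = 0) -> lie_act x m = 0.

Lemma tensorial_controlled M : tensorial N M -> controlled M.
Proof.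
elim=> {M} [k|M X _ IH _ IH' [m m']|M X f f_inj _ IH m|X M q q_surj _ IH m].
- elim: k => [|k IH] m; first by exists [::].
  elim/tensor_power_ind: m => [|u v [s sP] [s' sP']|r u].
  + by exists [::] => x _; exact: lie_act0.
  + exists (s ++ s') => x xs; rewrite lie_actD sP ?sP' ?addr0 // => r rs; apply: xs.
      by rewrite mem_cat rs orbT.
    by rewrite mem_cat rs.
  + have [s sP] := IH u; exists (r :: s) => x xs; rewrite act_tcons xs ?mem_head //.
    by rewrite tcons0l add0r sP ?tcons0r // => r' rs; apply: xs; rewrite inE rs orbT.
- have [[s sP] [s' sP']] := (IH m, IH' m').
  exists (s ++ s') => x xs; congr (_, _); [apply: sP | apply: sP'] => r rs; apply: xs.
    by rewrite mem_cat rs.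
  by rewrite mem_cat rs orbT.
- have [s sP] := IH (f m); exists s => x /sP; rewrite -lie_hom_act -(raddf0 f).
  exact: f_inj.
- have [u <-] := q_surj m; have [s sP] := IH u; exists s => x /sP e.
  by rewrite -lie_hom_act e raddf0.
Qed.

Lemma controlled_seq M (ms : seq M) : controlled M -> exists s : seq N,
  forall x : L, (forall r, r \in s -> lie_act x r = 0) ->
    forall m, m \in ms -> lie_act x m = 0.
Proof.
move=> cM; elim: ms => [|m ms [s sP]]; first by exists [::].
have [s' sP'] := cM m; exists (s ++ s') => x xs m'; rewrite inE => /predU1P[->|].
  by apply: sP' => r rs; apply: xs; rewrite mem_cat rs orbT.
by apply: sP => r rs; apply: xs; rewrite mem_cat rs.
Qed.

Hypothesis dense : acts_densely A N.

Lemma tensorial_dense M : tensorial N M -> acts_densely A M.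
Proof.
move=> /tensorial_controlled cM ms x; have [s sP] := controlled_seq ms cM.
have [y Ay yP] := dense s x; exists y => // m mms.
apply/eqP; rewrite -subr_eq0 -scaleN1r addrC -lie_actPl; apply/eqP.
by apply: sP mms => r /yP e; rewrite lie_actPl e scaleN1r addNr.
Qed.

Lemma dense_elt M (m : M) (x : L) : acts_densely A M ->
  exists y : lie_sub A, lie_act (lie_sub_val y) m = lie_act x m.
Proof.
move=> dM; have [y Ay yP] := dM [:: m] x.
by exists (exist _ y Ay); exact: yP (mem_head _ _).
Qed.

(** An [A]-linear map commutes with [x] because some element of [A] agrees with
    [x] on both an argument and its image. *)
Lemma res_hom_full M X (g : lie_hom (res M) (res X)) :
  tensorial N M -> tensorial N X -> exists f : lie_hom M X, res_hom A f = g.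
Proof.
move=> tM tX; have dMX := tensorial_dense (tensorial_sum tM tX).
have gl : linear (g : M -> X) by move=> c u v; exact: (linearP g).
have ga (x : L) m : (g : M -> X) (lie_act x m) = lie_act x ((g : M -> X) m).
  have [y [e1 e2]] := dense_elt ((m, (g : M -> X) m) : dsum2 M X) x dMX.
  by rewrite -e1 -e2; exact: (lie_hom_act g y m).
by exists (lie_hom_of gl ga); exact: lie_hom_ext.
Qed.

Lemma res_hom_faithful M X (f f' : lie_hom M X) : res_hom A f = res_hom A f' -> f = f'.
Proof.
move=> e; apply: lie_hom_ext => m.
exact: (congr1 (fun h : lie_hom (res M) (res X) => h m) e).
Qed.

(** Density on the single vectors already makes every [A]-submodule stable under
    [L]. *)
Lemma res_submodule M (S : submodule (res M)) : acts_densely A M ->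
  exists S' : submodule M, forall m, (m \in S') <-> (m \in S).
Proof.
move=> dM; have Sact (x : L) m : m \in S -> lie_act x m \in S.
  move=> Sm; have [y <-] := dense_elt m x dM; exact: (submodule_act (s := S) y Sm).
exists (@submodule_of K L M (fun m => m \in S) (rpred0 S)
  (fun c u v => @submodule_closed K _ (res M) S c u v) Sact) => m.
exact: submodule_ofP.
Qed.

Lemma res_tensor_power k : exists f : lie_hom (res (tensor_power N k)) (tensor_power (res N) k),
  @is_iso (lie_category _) _ _ f.
Proof.
elim: k => [|k [f f_iso]].
  by exists (unres_unit A); exists (res_unit A); split; apply: lie_hom_ext.
exists (lie_comp (tensor_map (lie_id (res N)) f) (unres_tensor A N (tensor_power N k))).
apply: lie_comp_iso.
  by exists (res_tensor A N (tensor_power N k)); split; apply: lie_hom_ext.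
by apply: tensor_map_iso => //; exists (lie_id _); split; apply: lie_hom_ext.
Qed.

Lemma res_tensorial M : tensorial N M -> tensorial (res N) (res M).
Proof.
elim=> {M} [k|M X _ IH _ IH'|M X f f_inj _ IH|X M q q_surj _ IH].
- have [f f_iso] := res_tensor_power k.
  exact: tensorial_sub (iso_inj f_iso) (tensorial_power _ k).
- pose f := hom_pair (res_hom A (dsum2_fst M X)) (res_hom A (dsum2_snd M X)).
  apply: (@tensorial_sub _ _ _ _ _ f _ (tensorial_sum IH IH')).
  by move=> [u u'] [v v'] [-> ->].
- exact: (@tensorial_sub _ _ _ _ _ (res_hom A f) f_inj IH).
- exact: (@tensorial_quot _ _ _ _ _ (res_hom A q) q_surj IH).
Qed.

(** The construction of [M] from tensor powers is repeated over [L]: the submodules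
    and kernels that occur are stable under [L] by density. *)
Lemma tensorial_res_ess (M : lieModule (lie_sub A)) : tensorial (res N) M ->
  exists2 M', tensorial N M' & exists f : lie_hom (res M') M, @is_iso (lie_category _) _ _ f.
Proof.
elim=> {M} [k|M X _ [M' tM [f f_iso]] _ [X' tX [g g_iso]]
  |M X i i_inj _ [X' tX [g g_iso]]|X M q q_surj _ [X' tX [g g_iso]]].
- by exists (tensor_power N k); [exact: tensorial_power | exact: res_tensor_power].
- exists (dsum2 M' X'); first exact: tensorial_sum.
  exists (hom_pair (lie_comp f (res_hom A (dsum2_fst M' X')))
                   (lie_comp g (res_hom A (dsum2_snd M' X')))).
  move: f_iso g_iso => /is_isoP[f' [fK fK']] /is_isoP[g' [gK gK']].
  apply: bij_iso => [[u u'] [v v'] [/(can_inj fK) -> /(can_inj gK) ->] //|[m x]].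
  by exists (f' m, g' x); congr (_, _); [exact: fK' | exact: gK'].
- move: g_iso => /is_isoP[g' [gK gK']].
  pose j := lie_comp g' i; have j_inj : injective j by move=> u v /(can_inj gK')/i_inj.
  have [S SP] := res_submodule (hom_image j (submodule_full M)) (tensorial_dense tX).
  exists (sub_module S); first exact: tensorial_sub (@sub_incl_inj _ _ _ S) tX.
  have jS m : j m \in S by apply/SP/hom_imageP; exists m; rewrite ?submodule_fullP.
  pose h m : res (sub_module S) := exist _ (j m) (jS m).
  have hl : linear h by move=> c u v; apply/val_inj; exact: linearP.
  have ha (x : lie_sub A) m : h (lie_act x m) = lie_act x (h m).
    by apply/val_inj; exact: (lie_hom_act j x m).
  have [||k [hK kK]] := @lie_hom_inverse _ _ _ _ (lie_hom_of hl ha).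
  + by move=> u v /(congr1 val)/j_inj.
  + move=> [x Sx]; have /SP/hom_imageP[m _ e] := Sx.
    by exists m; apply/val_inj.
  + by exists k; apply/is_isoP; exists (lie_hom_of hl ha).
- move: g_iso => /is_isoP[g' [gK gK']].
  pose p := lie_comp q g.
  have [S SP] := res_submodule (hom_preimage p (submodule_zero M)) (tensorial_dense tX).
  exists (quot_module S); first exact: tensorial_quot (@quot_proj_surj _ _ _ S) tX.
  have p_surj m : exists u, p u = m.
    by have [u <-] := q_surj m; exists (g' u); rewrite lie_compE gK'.
  pose pre m := sval (cid (p_surj m)).
  have preK m : p (pre m) = m by exact: (svalP (cid (p_surj m))).
  pose h m : res (quot_module S) := quot_proj S (pre m).
  have hP (u v : X') : quot_proj S u = quot_proj S v <-> p u = p v.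
    rewrite quot_projP SP hom_preimageP submodule_zeroP (linearB p).
    by split=> [/eqP|->]; rewrite ?subrr // subr_eq0 => /eqP.
  have hl : linear h.
    move=> c u v; rewrite /h -[RHS](linearP (quot_proj S)); apply/hP.
    by rewrite [RHS](linearP p) !preK.
  have ha (x : lie_sub A) m : h (lie_act x m) = lie_act x (h m).
    rewrite /h -[RHS](lie_hom_act (quot_proj S)); apply/hP.
    by rewrite [RHS](lie_hom_act p x) !preK.
  have h_inj : injective h by move=> u v /hP; rewrite !preK.
  have h_surj w : exists m, h m = w.
    by have [u <-] := quot_proj_surj w; exists (p u); apply/hP; rewrite preK.
  have [k [hK kK]] := @lie_hom_inverse _ _ _ _ (lie_hom_of hl ha) h_inj h_surj.
  by exists k; apply/is_isoP; exists (lie_hom_of hl ha).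
Qed.

End Dense.

(** * The restriction functor *)

Section RestrictMovable.
Context (K : fieldType) (L : lieAlgType K) (A : lie_subalgebra L) (N : lieModule L).
Hypothesis dense : acts_densely A N.

(** The conditions on the operators only concern their values at the vectors of [s]
    and [t], and those of [U_o] at the vectors [D_o x]; elements of [A] with the
    same finitely many values do as well. *)
Lemma movable_restrict : movable N -> movable (lie_restrict A N).
Proof.
move=> mv s; have [adm adm0 adm_step] := mv s; exists adm => // t adm_t.
have [q [ops [adm_q [ops_s ops_t ops1]]]] := adm_step t adm_t.
have wit (o : L * L) : exists o' : lie_sub A * lie_sub A,
    (forall r : N, r \in s ++ t ++ [seq lie_act o.2 x | x <- s] ->
       lie_act (lie_sub_val o'.1) r = lie_act o.1 r) /\
    (forall r : N, r \in s ++ t -> lie_act (lie_sub_val o'.2) r = lie_act o.2 r).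
  have [y1 A1 y1P] := dense (s ++ t ++ [seq lie_act o.2 x | x <- s]) o.1.
  have [y2 A2 y2P] := dense (s ++ t) o.2.
  by exists (exist _ y1 A1, exist _ y2 A2).
pose f o := sval (cid (wit o)); have fP o := svalP (cid (wit o)).
exists q, [seq f o | o <- ops]; split=> //; split.
- move=> _ x /mapP[o oo ->] xs; have [f1 f2] := fP o.
  rewrite -[lie_act (f o).1 x]/(lie_act (lie_sub_val (f o).1) (x : N)).
  rewrite -[lie_act (f o).2 x]/(lie_act (lie_sub_val (f o).2) (x : N)).
  rewrite f1 ?f2; [exact: ops_s | by rewrite mem_cat xs..].
- move=> _ y /mapP[o oo ->] yt; have [f1 f2] := fP o.
  rewrite -[lie_act (f o).1 y]/(lie_act (lie_sub_val (f o).1) (y : N)).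
  rewrite -[lie_act (f o).2 y]/(lie_act (lie_sub_val (f o).2) (y : N)).
  by rewrite f1 ?f2; [exact: ops_t | rewrite !mem_cat yt ?orbT..].
- move=> x xs; rewrite -[RHS](ops1 x xs) /casimir big_map; apply: eq_bigr => o _.
  have [f1 f2] := fP o.
  rewrite -[LHS]/(lie_act (lie_sub_val (f o).1) (lie_act (lie_sub_val (f o).2) (x : N))).
  rewrite f2 ?mem_cat ?xs // f1 // !mem_cat; apply/orP; right; apply/orP; right.
  exact: map_f.
Qed.

End RestrictMovable.

Section RestrictFunctor.
Context (K : fieldType) (L : lieAlgType K) (A : lie_subalgebra L) (N : lieModule L).
Hypothesis K0 : forall n, n.+1%:R != 0 :> K.
Hypothesis mv : movable N.
Hypothesis dense : acts_densely A N.
Local Notation res := (lie_restrict A).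

Let mvA : movable (res N) := movable_restrict dense mv.
Let objP M := tensor_category_objP K0 mv M.
Let objAP M := tensor_category_objP K0 mvA M.

Let C := tensor_category (movable_closed K0 mv).
Let D := tensor_category (movable_closed K0 mvA).

Lemma res_obj M : tensor_category_obj N M -> tensor_category_obj (res N) (res M).
Proof. by move=> /objP tM; apply/objAP; exact: res_tensorial. Qed.

Definition restriction_functor : functor C D.
Proof.
refine (@Functor C D (fun M => exist _ (res (sval M)) (res_obj (svalP M)))
    (fun M X f => res_hom A f) _ _).
- by move=> M; exact: (@lie_hom_ext _ _ (res (sval M)) (res (sval M))).
- by move=> M X Y f g; exact: (@lie_hom_ext _ _ (res (sval M)) (res (sval Y))).
Defined.

Definition restriction_monoidal : monoidal_functor C D.
Proof.
refine (@MonoidalFunctor C D restriction_functor (res_unit A) (res_unit_iso A)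
  (fun M X => res_tensor A (sval M) (sval X))
  (fun M X => res_tensor_iso A (sval M) (sval X)) _ _ _ _).
- move=> [M oM] [M' oM'] [X oX] [X' oX'] f g.
  apply: (@tensor_hom_ext K _ (res M) (res X) (res (tensor_module M' X'))) => m n.
  transitivity (tens (f m) (g n)); first exact: (tensor_mapE (res_hom A f) (res_hom A g)).
  exact/esym/(tensor_mapE f g).
- move=> [M oM] [X oX] [Y oY].
  apply: (@tensor_hom3_ext K _ (res M) (res X) (res Y)
    (res (tensor_module M (tensor_module X Y)))) => m n p.
  transitivity (tens m (tens n p : tensor_module X Y)).
    etransitivity; last exact: (tensor_assocE m n p).
    exact: (congr1 (tensor_assoc M X Y)
      (tensor_mapE (res_tensor A M X) (lie_id (res Y)) (tens m n) p)).
  apply/esym; etransitivity; last first.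
    exact: (tensor_mapE (lie_id (res M)) (res_tensor A X Y) m (tens n p)).
  exact: (congr1 (tensor_map (lie_id (res M)) (res_tensor A X Y))
      (@tensor_assocE K _ (res M) (res X) (res Y) m n p)).
- move=> [M oM].
  apply: (@tensor_hom_ext K _ (triv_module (lie_sub A)) (res M) (res M)) => c m.
  transitivity ((c : K) *: (m : M)); last exact/esym/(@tensor_lunitE K _ (res M) c m).
  etransitivity; last exact: (@tensor_lunitE K _ M c m).
  exact: (congr1 (tensor_lunit M) (tensor_mapE (res_unit A) (lie_id (res M)) c m)).
- move=> [M oM].
  apply: (@tensor_hom_ext K _ (res M) (triv_module (lie_sub A)) (res M)) => m c.
  transitivity ((c : K) *: (m : M)); last exact/esym/(@tensor_runitE K _ (res M) m c).
  etransitivity; last exact: (@tensor_runitE K _ M m c).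
  exact: (congr1 (tensor_runit M) (tensor_mapE (lie_id (res M)) (res_unit A) m c)).
Defined.

Lemma restriction_equivalence : is_equivalence restriction_functor.
Proof.
apply: fully_faithful_equivalence => [[M oM] [X oX] g|[M oM] [X oX] f f'|[M oM]].
- by apply: (res_hom_full dense g); apply/objP.
- exact: res_hom_faithful.
- have [M' tM' [f f_iso]] := tensorial_res_ess dense ((objAP M).1 oM).
  by exists (exist _ M' ((objP M').2 tM')), f.
Qed.

Lemma restriction_monoidally_equivalent :
  exists (hN : tensor_category_closed N) (hA : tensor_category_closed (res N)),
    monoidally_equivalent (tensor_category hN) (tensor_category hA).
Proof.
exists (movable_closed K0 mv), (movable_closed K0 mvA), restriction_monoidal.
exact: restriction_equivalence.
Qed.

End RestrictFunctor.

(** * Dual systems and the Mackey Lie algebras *)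

Section DualSystem.
Context (K : fieldType) (V W : lmodType K).
Variable p : {bilinear V -> W -> K | *%R & *%R}.
Hypothesis nd : nondegenerate_pairing p.
Implicit Type q : seq (V * W).

Definition proj_l q (v : V) : V := \sum_(o <- q) p v o.2 *: o.1.
Definition proj_r q (w : W) : W := \sum_(o <- q) p o.1 w *: o.2.

Lemma pairZl c v w : p (c *: v) w = c * p v w. Proof. exact: linearZl_LR. Qed.
Lemma pairZr c v w : p v (c *: w) = c * p v w. Proof. exact: linearZr. Qed.
Lemma pairDl v v' w : p (v + v') w = p v w + p v' w. Proof. exact: linearDl. Qed.
Lemma pairDr v w w' : p v (w + w') = p v w + p v w'. Proof. exact: linearDr. Qed.

Lemma proj_adjoint q v w : p (proj_l q v) w = p v (proj_r q w).
Proof.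
rewrite /proj_l /proj_r; elim: q => [|o q IH].
  by rewrite !big_nil linear0l linear0r.
by rewrite !big_cons pairDl pairDr IH pairZl pairZr mulrC.
Qed.

Lemma proj_l_linear q : linear (proj_l q).
Proof.
move=> c u v; rewrite /proj_l scaler_sumr -big_split; apply: eq_bigr => o _.
by rewrite pairDl pairZl scalerDl scalerA.
Qed.
Lemma proj_r_linear q : linear (proj_r q).
Proof.
move=> c u v; rewrite /proj_r scaler_sumr -big_split; apply: eq_bigr => o _.
by rewrite pairDr pairZr scalerDl scalerA mulrC.
Qed.
Lemma proj_lB q : {morph proj_l q : u v / u - v}.
Proof. exact: (raddfB (linear_of (@proj_l_linear q))). Qed.
Lemma proj_rB q : {morph proj_r q : u v / u - v}.
Proof. exact: (raddfB (linear_of (@proj_r_linear q))). Qed.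

(** Idempotence of the operator of finite rank [proj_l q] replaces the conditions
    [p v_i w_j = delta_ij] on the pairs [(v_i, w_i)] of [q]: it is an identity
    between operators, stable under the extension steps below. *)
Definition idem q : Prop := forall v, proj_l q (proj_l q v) = proj_l q v.

Lemma idem_r q w : idem q -> proj_r q (proj_r q w) = proj_r q w.
Proof. by move=> iq; apply: (pairing_inj nd) => v; rewrite -!proj_adjoint iq. Qed.

Definition extends q q' : Prop :=
  [/\ idem q', forall v, proj_l q v = v -> proj_l q' v = v
    & forall w, proj_r q w = w -> proj_r q' w = w].

Lemma extends_cons q v w : idem q -> proj_l q v = 0 -> proj_r q w = 0 ->
  p v w = 1 -> extends q ((v, w) :: q).
Proof.
move=> iq qv qw vw.
have lE u : proj_l ((v, w) :: q) u = p u w *: v + proj_l q u by rewrite /proj_l big_cons.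
have rE u : proj_r ((v, w) :: q) u = p v u *: w + proj_r q u by rewrite /proj_r big_cons.
split=> [u|u qu|u qu].
- rewrite !lE proj_l_linear qv scaler0 add0r iq.
  by rewrite pairDl pairZl vw mulr1 proj_adjoint qw linear0r addr0.
- by rewrite lE qu -{1}qu proj_adjoint qw linear0r scale0r add0r.
- by rewrite rE qu -{1}qu -proj_adjoint qv linear0l scale0r add0r.
Qed.

(** One step of a Gram-Schmidt process: [x] and a functional nonzero on its
    component are made orthogonal to [q]. *)
Lemma extends_l q x : idem q -> exists2 q', extends q q' & proj_l q' x = x.
Proof.
move=> iq; have [e|/eqP ne] := eqVneq (proj_l q x) x; first by exists q.
pose y := x - proj_l q x.
have qy : proj_l q y = 0 by rewrite proj_lB iq subrr.
have [f yf] : exists f, p y f != 0.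
  apply: contrapT => h; apply: ne; apply/eqP; rewrite eq_sym -subr_eq0; apply/eqP/nd.1 => f.
  by apply/eqP/negPn/negP => yf; apply: h; exists f.
pose f1 := (p y f)^-1 *: f; pose f' := f1 - proj_r q f1.
have qf : proj_r q f' = 0 by rewrite proj_rB idem_r // subrr.
have yf' : p y f' = 1.
  by rewrite linearBr -proj_adjoint qy linear0l subr0 pairZr mulVf.
exists ((y, f') :: q); first exact: extends_cons.
rewrite /proj_l big_cons -/(proj_l q x) /=.
suff -> : p x f' = 1 by rewrite scale1r subrK.
by rewrite -[x](subrK (proj_l q x)) pairDl yf' proj_adjoint qf linear0r addr0.
Qed.

Lemma extends_r q x : idem q -> exists2 q', extends q q' & proj_r q' x = x.
Proof.
move=> iq; have [e|/eqP ne] := eqVneq (proj_r q x) x; first by exists q.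
pose y := x - proj_r q x.
have qy : proj_r q y = 0 by rewrite proj_rB idem_r // subrr.
have [v vy] : exists v, p v y != 0.
  apply: contrapT => h; apply: ne; apply/eqP; rewrite eq_sym -subr_eq0; apply/eqP/nd.2 => v.
  by apply/eqP/negPn/negP => vy; apply: h; exists v.
pose v1 := (p v y)^-1 *: v; pose v' := v1 - proj_l q v1.
have qv : proj_l q v' = 0 by rewrite proj_lB iq subrr.
have vy' : p v' y = 1.
  by rewrite linearBl proj_adjoint qy linear0r subr0 pairZl mulVf.
exists ((v', y) :: q); first exact: extends_cons.
rewrite /proj_r big_cons -/(proj_r q x) /=.
suff -> : p v' x = 1 by rewrite scale1r subrK.
by rewrite -[x](subrK (proj_r q x)) pairDr vy' -proj_adjoint qv linear0l addr0.
Qed.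

Lemma dual_system (G : seq V) (F : seq W) : exists q,
  [/\ idem q, forall v, v \in G -> proj_l q v = v
    & forall w, w \in F -> proj_r q w = w].
Proof.
elim: G => [|x G [q [iq qG qF]]].
  elim: F => [|x F [q [iq _ qF]]].
    by exists [::]; split=> // v; rewrite /proj_l !big_nil.
  have [q' [iq' _ ext] q'x] := extends_r x iq; exists q'; split=> // w.
  by rewrite inE => /predU1P[->|/qF/ext].
have [q' [iq' extl extr] q'x] := extends_l x iq; exists q'; split=> // w.
  by rewrite inE => /predU1P[->|/qG/extl].
by move=> /qF/extr.
Qed.

(** In infinite dimension some [x] is not fixed by the projection attached to a dual
    system for [G] and [F]; the pair is obtained by projecting [x], and a
    functional not vanishing on its projection, away from that system. *)
Lemma dual_pair (G : seq V) (F : seq W) : infinite_dim V -> exists e f,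
  [/\ p e f = 1, forall w, w \in F -> p e w = 0 & forall v, v \in G -> p v f = 0].
Proof.
move=> infV; have [q [iq qG qF]] := dual_system G F.
have [x xq] : exists x, proj_l q x <> x.
  apply: contrapT => h; apply: infV.
  exists (size q), (fun i => (nth (0, 0) q i).1) => v.
  exists (fun i => p v (nth (0, 0) q i).2).
  have {1}<- : proj_l q v = v by apply: contrapT => vq; apply: h; exists v.
  by rewrite /proj_l (big_nth (0, 0)) big_mkord.
pose e := x - proj_l q x.
have qe : proj_l q e = 0 by rewrite proj_lB iq subrr.
have [f ef] : exists f, p e f != 0.
  apply: contrapT => h; apply: xq; apply/eqP; rewrite eq_sym -subr_eq0; apply/eqP/nd.1 => f.
  by apply/eqP/negPn/negP => yf; apply: h; exists f.
pose f1 := (p e f)^-1 *: f.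
exists e, (f1 - proj_r q f1); split=> [|w /qF <-|v /qG <-].
- by rewrite linearBr -proj_adjoint qe linear0l subr0 pairZr mulVf.
- by rewrite -proj_adjoint qe linear0l.
- by rewrite proj_adjoint proj_rB idem_r // subrr linear0r.
Qed.

End DualSystem.

Lemma in_span_head (K : fieldType) (M : lmodType K) (x y : M) s :
  in_span [:: x, y & s] x.
Proof. by apply: in_span_mem; exact: mem_head. Qed.
Lemma in_span_next (K : fieldType) (M : lmodType K) (x y : M) s :
  in_span [:: x, y & s] y.
Proof. by apply: in_span_mem; rewrite in_cons mem_head orbT. Qed.

Section MovableGL.
Context (K : fieldType) (V W : lmodType K).
Variable p : {bilinear V -> W -> K | *%R & *%R}.
Hypothesis nd : nondegenerate_pairing p.
Local Notation N := (dsum2 (natural_module (glM p)) (dual_module nd)).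

Lemma rank1_linear (v : V) (w : W) : linear (fun x : V => p x w *: v).
Proof. by move=> c x y; rewrite pairDl pairZl scalerDl scalerA. Qed.
Definition rank1 v w : endo V := linear_of (rank1_linear v w).
Lemma rank1_glM v w : rank1 v w \in glM p.
Proof.
apply/asboolP => w'; exists (p v w' *: w) => x.
by rewrite -[rank1 v w x]/(p x w *: v) pairZl pairZr mulrC.
Qed.
Definition gl_rank1 v w : lie_sub (glM p) := exist _ (rank1 v w) (rank1_glM v w).

(** The sign is that of the dual action [- phi^*]. *)
Lemma gl_rank1E v w (x : N) :
  lie_act (gl_rank1 v w) x = ((p x.1 w *: v, - (p v x.2 *: w)) : N).
Proof.
congr (_, _); apply: (pairing_inj nd) => y; rewrite dual_actP linearNr.
by rewrite -[sub_endo _ y]/(p y w *: v) pairZl pairZr mulrC.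
Qed.

(** A dual system [q] for the components of [s] in [V] and in [W] writes the
    identity on them as a sum of operators of rank one. Each is factored through a
    new pair [e], [f] orthogonal to everything in sight: for [o] in [q], a vector
    of [V] goes to [e] under [e (x) o.2] and returns under [o.1 (x) f], and a vector of
    [W] goes to [f] under [o.1 (x) f] and returns under [e (x) o.2]; in the second case
    the two signs of the dual action cancel. *)
Lemma movable_gl : infinite_dim V -> movable N.
Proof.
move=> infV s.
have [q [_ qs1 qs2]] := dual_system nd (map fst s : seq V) (map snd s : seq W).
exists (fun t => forall (y : N) o, y \in t -> o \in q ->
  p y.1 o.2 = 0 /\ p o.1 y.2 = 0) => // t adm_t.
have [e [f [ef eF fG]]] := dual_pair nd
  ((map fst s : seq V) ++ (map fst t : seq V) ++ map fst q)
  ((map snd s : seq W) ++ (map snd t : seq W) ++ map snd q) infV.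
have e_s x : x \in s -> p e x.2 = 0 by move=> xs; apply: eF; rewrite mem_cat map_f.
have f_s x : x \in s -> p x.1 f = 0 by move=> xs; apply: fG; rewrite mem_cat map_f.
have e_t x : x \in t -> p e x.2 = 0.
  by move=> xt; apply: eF; rewrite !mem_cat [_ \in map snd t]map_f ?orbT.
have f_t x : x \in t -> p x.1 f = 0.
  by move=> xt; apply: fG; rewrite !mem_cat [_ \in map fst t]map_f ?orbT.
have e_q o : o \in q -> p e o.2 = 0.
  by move=> oq; apply: eF; rewrite !mem_cat [_ \in map snd q]map_f ?orbT.
have f_q o : o \in q -> p o.1 f = 0.
  by move=> oq; apply: fG; rewrite !mem_cat [_ \in map fst q]map_f ?orbT.
pose E : N := (e, 0); pose F : N := (0, f).
exists (E, F), ([seq (gl_rank1 o.1 f, gl_rank1 e o.2) | o <- q]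
  ++ [seq (gl_rank1 e o.2, gl_rank1 o.1 f) | o <- q]).
split=> [y o|].
  rewrite !inE => /orP[/eqP ->|/orP[/eqP ->|/adm_t]] /=; last exact.
    by move=> oq; rewrite e_q // linear0r.
  by move=> oq; rewrite f_q // linear0l.
have spanU (o : V * W) (x : N) : x \in s -> in_span [:: E, F & t] (lie_act (gl_rank1 o.1 f) x).
  move=> xs; have -> : lie_act (gl_rank1 o.1 f) x = (- p o.1 x.2) *: F.
    by rewrite gl_rank1E f_s // scale0r; congr (_, _); rewrite ?scaler0 ?scaleNr.
  by apply: in_spanZ; exact: in_span_next.
have spanD (o : V * W) (x : N) : x \in s -> in_span [:: E, F & t] (lie_act (gl_rank1 e o.2) x).
  move=> xs; have -> : lie_act (gl_rank1 e o.2) x = p x.1 o.2 *: E.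
    by rewrite gl_rank1E e_s // scale0r oppr0; congr (_, _); rewrite /= ?scaler0.
  by apply: in_spanZ; exact: in_span_head.
have killU (o : V * W) (y : N) : o \in q -> y \in t -> lie_act (gl_rank1 o.1 f) y = 0.
  by move=> oq yt; rewrite gl_rank1E f_t // (adm_t y o yt oq).2 !scale0r oppr0.
have killD (o : V * W) (y : N) : o \in q -> y \in t -> lie_act (gl_rank1 e o.2) y = 0.
  by move=> oq yt; rewrite gl_rank1E e_t // (adm_t y o yt oq).1 !scale0r oppr0.
split=> [o x|o y|x xs].
- by rewrite mem_cat => /orP[]/mapP[o' _ ->] xs; split; first [exact: spanU | exact: spanD].
- by rewrite mem_cat => /orP[]/mapP[o' oq ->] yt; split; first [exact: killU | exact: killD].
rewrite /casimir big_cat !big_map /=.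
have -> : \sum_(o <- q) lie_act (gl_rank1 o.1 f) (lie_act (gl_rank1 e o.2) x)
    = dsum2_inl (natural_module (glM p)) (dual_module nd) x.1.
  rewrite -{1}[x.1](qs1 x.1) ?map_f // /proj_l raddf_sum big_seq [RHS]big_seq.
  apply: eq_bigr => o oq; rewrite !gl_rank1E /= pairZl ef mulr1 e_s // !scale0r.
  by congr (_, _); rewrite oppr0 linear0r scale0r oppr0.
have -> : \sum_(o <- q) lie_act (gl_rank1 e o.2) (lie_act (gl_rank1 o.1 f) x)
    = dsum2_inr (natural_module (glM p)) (dual_module nd) x.2.
  rewrite -{1}[x.2](qs2 x.2) ?map_f // /proj_r raddf_sum big_seq [RHS]big_seq.
  apply: eq_bigr => o oq; rewrite !gl_rank1E /= f_s // scale0r linear0l scale0r.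
  by congr (_, _); rewrite linearNr pairZr ef mulr1 scaleNr opprK.
by case: x xs => a b _; congr (_, _); rewrite /= ?addr0 ?add0r.
Qed.

End MovableGL.

Section MovableIso.
Context (K : fieldType) (V : lmodType K).
Variable p : {bilinear V -> V -> K | *%R & *%R}.
(** The sign [1] is the orthogonal case, [- 1] the symplectic one. *)
Variable eps : K.
Hypothesis nd : nondegenerate_pairing p.
Hypothesis p_eps : forall v w, p v w = eps * p w v.
Hypothesis eps2 : eps * eps = 1.
Local Notation N := (natural_module (isoM p)).

Lemma rank2_linear (u v : V) : linear (fun x : V => p v x *: u - (eps * p u x) *: v).
Proof.
move=> c x y; rewrite !pairDr !pairZr mulrDr mulrCA !scalerDl.
by rewrite opprD addrACA scalerBr !scalerA.
Qed.
(** The operators [u ^ v] of the orthogonal and [u v] of the symplectic Lie algebra,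
    under the identifications with the exterior and the symmetric square. *)
Definition rank2 u v : endo V := linear_of (rank2_linear u v).
Lemma rank2_isoM u v : rank2 u v \in isoM p.
Proof.
apply/asboolP => x y.
rewrite -[rank2 u v x]/(p v x *: u - (eps * p u x) *: v).
rewrite -[rank2 u v y]/(p v y *: u - (eps * p u y) *: v).
rewrite linearBl linearBr !pairZl !pairZr (p_eps x u) (p_eps x v).
rewrite -!mulrA [p u y * _]mulrCA (mulrA eps eps) eps2 mul1r.
rewrite (mulrCA (p v y)) [p v x * p u y]mulrC [p v y * p u x]mulrC.
by rewrite addrC subrKA subrr.
Qed.
Definition iso_rank2 u v : lie_sub (isoM p) := exist _ (rank2 u v) (rank2_isoM u v).
Lemma iso_rank2E u v (x : N) :
  lie_act (iso_rank2 u v) x = (p v x *: u - (eps * p u x) *: v : N).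
Proof. by []. Qed.

(** As for [gl], a vector of [s] is moved to a multiple of a new vector [e] and
    back. The second terms of the operators, forced by the invariance of the form,
    vanish on [e] and [s] by orthogonality, except that [rank2 o.1 f] also sends [s]
    into the line of [f]; this is why a pair and not a single vector is added. *)
Lemma movable_iso : infinite_dim V -> movable N.
Proof.
move=> infV s; have [q [_ qs _]] := dual_system nd (s : seq V) [::].
exists (fun t => forall (y : N) o, y \in t -> o \in q -> p o.1 y = 0 /\ p o.2 y = 0) => // t adm_t.
pose G : seq V := (s : seq V) ++ (t : seq V) ++ map fst q ++ map snd q.
have [e [f [ef eF fG]]] := dual_pair nd G G infV.
have fF w : w \in G -> p f w = 0 by move=> /fG wf; rewrite p_eps wf mulr0.
have sG x : x \in s -> x \in G by move=> xs; rewrite mem_cat xs.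
have tG x : x \in t -> x \in G by move=> xt; rewrite !mem_cat xt orbT.
have q1G o : o \in q -> o.1 \in G by move=> oq; rewrite !mem_cat (map_f fst oq) !orbT.
have q2G o : o \in q -> o.2 \in G by move=> oq; rewrite !mem_cat (map_f snd oq) !orbT.
have sym0 v w : p v w = 0 -> p w v = 0 by move=> vw; rewrite p_eps vw mulr0.
exists (e, f), [seq (iso_rank2 o.1 f, iso_rank2 e o.2) | o <- q].
split=> [y o|].
  rewrite !inE => /orP[/eqP ->|/orP[/eqP ->|/adm_t]] /=; last exact.
    by move=> oq; split; apply: sym0; apply: eF; [exact: q1G | exact: q2G].
  by move=> oq; split; apply: sym0; apply: fF; [exact: q1G | exact: q2G].
have Us (o : V * V) (x : N) : x \in s ->
    lie_act (iso_rank2 o.1 f) x = (- (eps * p o.1 x)) *: (f : N).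
  by move=> /sG xG; rewrite iso_rank2E (fF _ xG) scale0r sub0r scaleNr.
have Ds (o : V * V) (x : N) : x \in s -> lie_act (iso_rank2 e o.2) x = p o.2 x *: (e : N).
  by move=> /sG xG; rewrite iso_rank2E (eF _ xG) mulr0 scale0r subr0.
split=> [_ x /mapP[o oq ->] xs|_ y /mapP[o oq ->] yt|x xs].
- rewrite [lie_act _ _](Us o x xs) [lie_act (_, _).2 _](Ds o x xs).
  split; apply: in_spanZ; [exact: in_span_next | exact: in_span_head].
- have [y1 y2] := adm_t y o yt oq; rewrite !iso_rank2E y1 y2 eF ?fF; try exact: tG.
  by rewrite mulr0 !scale0r subrr.
rewrite -[RHS](qs x xs) /casimir big_map /proj_l big_seq [RHS]big_seq.
apply: eq_bigr => o oq; rewrite (Ds o x xs) lie_actZ iso_rank2E.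
rewrite (p_eps f) ef mulr1 (sym0 e o.1) ?eF ?q1G // mulr0 scale0r subr0.
by rewrite (p_eps x) scalerA mulrC.
Qed.

End MovableIso.

Lemma movable_mackey (K : fieldType) (g : mackey_data K) : movable (mackey_module g).
Proof.
case: g => [V W p infV _ nd|V p infV nd sym|V p infV nd sym] /=.
- exact: movable_gl.
- by apply: (@movable_iso K V p 1) => // [v w|]; rewrite ?mul1r.
- by apply: (@movable_iso K V p (-1)) => // [v w|]; rewrite ?mulN1r ?opprK.
Qed.

Theorem corollary7p6 (R : realType) (g : mackey_data R[i])
    (a : lie_subalgebra (mackey_lie g)) :
  acts_densely a (mackey_module g) ->
  exists (hg : tensor_category_closed (mackey_module g))
         (ha : tensor_category_closed (lie_restrict a (mackey_module g))),
    monoidally_equivalent (tensor_category hg) (tensor_category ha).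
Proof.
move=> dense; apply: restriction_monoidally_equivalent => // [n|].
  by rewrite Num.Theory.pnatr_eq0.
exact: movable_mackey.
Qed.
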